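(* Let $\mathbb{F}$ be any field. There are, up to isomorphism, exactly three nilpotent symplectic alternating algebras $L$ over $\mathbb{F}$ of dimension $10$ that have an isotropic center of dimension $3$ and where $\dim L^3=5$. These are given by the presentations $$\mathcal{P}_{10}^{(3,1)}:\quad (x_2y_4,y_5)=1,\ (x_1y_3,y_5)=1,\ (y_1y_2,y_5)=1;$$ $$\mathcal{P}_{10}^{(3,2)}:\quad (x_2y_4,y_5)=1,\ (x_1y_3,y_5)=1,\ (y_1y_2,y_5)=1,\ (y_2y_4,y_3)=1;$$ $$\mathcal{P}_{10}^{(3,3)}:\quad (x_2y_4,y_5)=1,\ (x_1y_3,y_4)=1,\ (y_1y_2,y_5)=1.$$
   Context: A symplectic alternating algebra (SAA) over a field $\mathbb{F}$ is a finite-dimensional vector space $L$ over $\mathbb{F}$ with a non-degenerate alternating bilinear form $(\ ,\ )$ and a bilinear product $\cdot$ satisfying $u\cdot u=0$ for all $u$ and $(u\cdot v,w)=(v\cdot w,u)$ for all $u,v,w\in L$. No associativity or Jacobi identity is assumed. The map $(u,v,w)\mapsto(uv,w)$ is then an alternating trilinear form. A standard basis (in dimension $10$) is a basis $x_1,y_1,\ldots,x_5,y_5$ with $(x_i,x_j)=(y_i,y_j)=0$ and $(x_i,y_j)=\delta_{ij}$ for all $i,j$. Presentations: $L$ is given by a presentation if there is a standard basis for which the listed values of triples $(uv,w)$ hold and $(uv,w)=0$ for all triples of basis elements that are not a reordering of a listed one. Isomorphisms are linear bijections preserving product and form. $L^1=L$, $L^{m+1}=L^mL$ (span of products). $L$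 is nilpotent if $L^{m+1}=\{0\}$ for some $m\ge 0$. The center is $Z(L)=\{x\in L: xL=\{0\}\}$; it is isotropic if $(u,v)=0$ for all $u,v\in Z(L)$. *)

(* Defs.v *)
From HB Require Import structures.
From mathcomp Require Import all_boot all_order all_algebra.

Set Implicit Arguments.
Unset Strict Implicit.
Unset Printing Implicit Defensive.

Import GRing.Theory.
Local Open Scope ring_scope.

Record saa (F : fieldType) : Type := SAA {
  saa_space :> vectType F;
  saa_form : {biscalar saa_space};
  saa_mul : {bilinear saa_space -> saa_space -> saa_space};
  saa_form_alt : forall u, saa_form u u = 0;
  saa_form_nondeg : forall u, (forall v, saa_form u v = 0) -> u = 0;
  saa_mul_alt : forall u, saa_mul u u = 0;
  saa_mul_cyc : forall u v w,
    saa_form (saa_mul u v) w = saa_form (saa_mul v w) u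
}.

Section Algebra.
Context {F : fieldType}.
Implicit Type L : saa F.

Definition saa_iso (L M : saa F) : Prop :=
  exists f : {linear L -> M},
    [/\ bijective f,
        forall u v, f (saa_mul L u v) = saa_mul M (f u) (f v)
      & forall u v, saa_form M (f u) (f v) = saa_form L u v].

(* The span of the products u v with u in U and v in V; products of basis
   vectors suffice by bilinearity, see saa_prodvP. *)
Definition saa_prodv L (U V : {vspace L}) : {vspace L} :=
  <<[seq saa_mul L u v | u <- vbasis U, v <- vbasis V]>>%VS.

Lemma saa_prodvP L (U V W : {vspace L}) :
  reflect (forall u v, u \in U -> v \in V -> saa_mul L u v \in W)
          (saa_prodv U V <= W)%VS.
Proof.
apply: (iffP span_subvP) => [sW u v uU vV | sW w].
  rewrite (coord_vbasis uU) (coord_vbasis vV) linear_sumr.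
  apply: rpred_sum => j _; rewrite linear_sumlz.
  apply: rpred_sum => i _; rewrite linearZl_LR linearZr_LR.
  do 2!apply: memvZ.
  apply: sW; apply: allpairs_f; apply: mem_nth; by rewrite size_tuple.
by case/allpairsP=> -[u v] /= [uU vV ->]; apply: sW; apply: vbasis_mem.
Qed.

(* Indexed as in L^1 = L and L^(m+1) = L^m L; the value at 0 is junk. *)
Definition saa_lower L (m : nat) : {vspace L} :=
  iter m.-1 (fun U => saa_prodv U fullv) fullv.

Definition saa_nilpotent L : Prop := exists m, saa_lower L m.+1 = 0%VS.

(* The kernel of the linear map x |-> (u |-> x u), see saa_centerP. *)
Definition saa_center L : {vspace L} :=
  lker (linfun (fun x : L => linfun (saa_mul L x))).

Lemma saa_centerP L (x : L) :
  reflect (forall u, saa_mul L x u = 0) (x \in saa_center L).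
Proof.
have lin : linear (fun y : L => linfun (saa_mul L y)).
  by move=> a y z; apply/lfunP => u; rewrite !lfun_simp; exact: linearPl (saa_mul L) u a y z.
pose f := GRing.isLinear.Build _ _ _ _ _ lin.
pose g : {linear L -> 'End(L)} := HB.pack (fun y : L => linfun (saa_mul L y)) f.
rewrite memv_ker (lfunE g); apply: (iffP eqP) => [x0 u | x0].
  by rewrite -(lfunE (saa_mul L x)) [linfun _]x0 lfunE.
by apply/lfunP => u; rewrite lfunE zero_lfunE; apply: x0.
Qed.

Definition saa_isotropic L (U : {vspace L}) : Prop :=
  forall u v, u \in U -> v \in U -> saa_form L u v = 0.

End Algebra.

(* The labels x_1, ..., x_5 and y_1, ..., y_5, as left and right summands;
   gx and gy are meant for 1 <= i <= 5. *)
Definition gen : finType := ('I_5 + 'I_5)%type.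
Definition gx (i : nat) : gen := inl (inZp i.-1).
Definition gy (i : nat) : gen := inr (inZp i.-1).

Definition standard_basis (F : fieldType) (L : saa F) (b : gen -> L) : Prop :=
  [/\ basis_of fullv (codom b),
      forall i j, saa_form L (b (inl i)) (b (inl j)) = 0,
      forall i j, saa_form L (b (inr i)) (b (inr j)) = 0
    & forall i j, saa_form L (b (inl i)) (b (inr j)) = (i == j)%:R].

(* An entry (a, b, c, r) stands for (a b, c) = r. *)
Definition presentation (F : fieldType) := seq (gen * gen * gen * F).

Definition has_presentation (F : fieldType) (L : saa F) (P : presentation F) :
    Prop :=
  exists e : gen -> L,
    [/\ standard_basis e,
        forall a b c r, (a, b, c, r) \in P ->
          saa_form L (saa_mul L (e a) (e b)) (e c) = r
      & forall a b c,
          (forall a' b' c' r, (a', b', c', r) \in P ->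
             ~~ perm_eq [:: a; b; c] [:: a'; b'; c']) ->
          saa_form L (saa_mul L (e a) (e b)) (e c) = 0].

Definition P10_3_1 (F : fieldType) : presentation F :=
  [:: (gx 2, gy 4, gy 5, 1); (gx 1, gy 3, gy 5, 1); (gy 1, gy 2, gy 5, 1)].

Definition P10_3_2 (F : fieldType) : presentation F :=
  [:: (gx 2, gy 4, gy 5, 1); (gx 1, gy 3, gy 5, 1); (gy 1, gy 2, gy 5, 1);
      (gy 2, gy 4, gy 3, 1)].

Definition P10_3_3 (F : fieldType) : presentation F :=
  [:: (gx 2, gy 4, gy 5, 1); (gx 1, gy 3, gy 4, 1); (gy 1, gy 2, gy 5, 1)].

Definition in_class (F : fieldType) (L : saa F) : Prop :=
  [/\ saa_nilpotent L,
      \dim {:L} = 10%N,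
      saa_isotropic (saa_center L),
      \dim (saa_center L) = 3%N
    & \dim (saa_lower L 3) = 5%N].

(* Main.v *)
Require Import Defs.
From HB Require Import structures.
From mathcomp Require Import all_boot all_order all_algebra.
From mathcomp Require Import ring.

(** Write [tri u v w = (u v, w)], [Z] for the center of an algebra [L] of the
    class and [Z^perp] for its orthogonal complement. Since [Z] is the radical
    of [tri], the algebra is encoded by an alternating trilinear form on the
    7-dimensional space [L / Z], together with the 4-dimensional symplectic
    subspace [Z^perp / Z], where [Z^perp = L^2]. The classification consists in
    bringing this form to a normal form.

    The second center [K = (L^3)^perp] has dimension 5. It lies in [L^2], by a
    comparison of two multiplication maps of rank 2 ([second_center_sub_orth]),
    and it is isotropic, since otherwise the lower central series would not
    reach zero ([second_center_isotropic]). So [K / Z] is a Lagrangian plane in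
    [L^2 / Z]. As [tri] vanishes whenever one argument is in [K] and another
    one in [L^2], the forms [tri u v _] with [u] and [v] in [L^2] are all
    multiples of a single nonzero functional, whose kernel is a hyperplane
    containing [L^2], the core of [L]. On the core [tri] is the product of an
    alternating form on [core / L^2], a plane, and one functional [alpha] on
    [L^2]. There are three possibilities, one for each presentation:
    [alpha = 0], [alpha] is nonzero but vanishes on [K], or [alpha] does not
    vanish on [K]. They are separated by invariants defined from the product
    and the form alone ([iso_core]).

    In each case the form has a unique shape. A basis of [K / Z] with a dual
    basis in [L^2 / Z], two elements of the core and one element outside it
    make up a frame. A frame extends by central elements to a standard basis
    ([frame_completion]), so only thirteen values of [tri] on the frame matter,
    and linear substitutions between the members of a frame make these equal
    to the prescribed ones ([normal_isotropic], [normal_rescale] and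
    [normal_nonisotropic]); no roots have to be extracted, so that this works
    over every field. A presentation determines the algebra up to isomorphism
    ([has_presentation_iso]), and [pres_alg] realises the three presentations.
    That these realisations belong to the class and have different invariants
    is a computation with lists of generators, because products of two basis
    vectors are multiples of basis vectors there. *)

Set Implicit Arguments.
Unset Strict Implicit.
Unset Printing Implicit Defensive.

Import GRing.Theory.
Local Open Scope ring_scope.

(** * The form and the triple product *)

Local Notation "''[' u , v ]" := (saa_form _ u v) : ring_scope.
Local Notation "u ** v" := (saa_mul _ u v) (at level 40, left associativity) : ring_scope.

(** The alternating trilinear form, which together with the non-degenerate
    form determines the product. *)
Definition tri (F : fieldType) (L : saa F) (u v w : L) : F := '[u ** v, w].

Section Forms.
Variables (F : fieldType) (L : saa F).
Implicit Types (u v w z : L) (U V W : {vspace L}).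

Lemma formC u v : '[u, v] = - '[v, u].
Proof.
have := saa_form_alt (u + v).
rewrite linearDr !linearDl !saa_form_alt add0r addr0 => /eqP.
by rewrite addr_eq0 => /eqP ->; rewrite opprK.
Qed.

Lemma saa_mulC u v : u ** v = - (v ** u).
Proof.
have := saa_mul_alt (u + v).
rewrite linearDr !linearDl !saa_mul_alt add0r addr0 => /eqP.
by rewrite addr_eq0 => /eqP ->; rewrite opprK.
Qed.

Lemma formDl u u' v : '[u + u', v] = '[u, v] + '[u', v].
Proof. exact: linearDl. Qed.
Lemma formDr u v v' : '[u, v + v'] = '[u, v] + '[u, v'].
Proof. exact: linearDr. Qed.
Lemma formZl a u v : '[a *: u, v] = a * '[u, v].
Proof. exact: linearZl_LR. Qed.
Lemma formZr a u v : '[u, a *: v] = a * '[u, v].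
Proof. exact: linearZr_LR. Qed.
Lemma formNl u v : '[- u, v] = - '[u, v].
Proof. exact: linearNl. Qed.
Lemma formNr u v : '[u, - v] = - '[u, v].
Proof. exact: linearNr. Qed.
Lemma form0l v : '[0, v] = 0.
Proof. exact: linear0l. Qed.
Lemma form0r v : '[v, 0] = 0.
Proof. exact: linear0r. Qed.
Lemma form_suml I r (P : pred I) (f : I -> L) v :
  '[\sum_(i <- r | P i) f i, v] = \sum_(i <- r | P i) '[f i, v].
Proof. exact: linear_sumlz. Qed.
Lemma form_sumr I r (P : pred I) (f : I -> L) v :
  '[v, \sum_(i <- r | P i) f i] = \sum_(i <- r | P i) '[v, f i].
Proof. exact: linear_sumr. Qed.
Definition formE := (formDl, formDr, formZl, formZr, formNl, formNr, form0l, form0r).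

Lemma tri_cyc u v w : tri u v w = tri v w u.
Proof. exact: saa_mul_cyc. Qed.
Lemma tri_swap u v w : tri u v w = - tri v u w.
Proof. by rewrite /tri saa_mulC formNl. Qed.
Lemma tri_swapr u v w : tri u v w = - tri u w v.
Proof. by rewrite tri_cyc tri_swap 2!tri_cyc. Qed.
Lemma tri_alt u v : tri u u v = 0.
Proof. by rewrite /tri saa_mul_alt form0l. Qed.
Lemma tri_altr u v : tri v u u = 0.
Proof. by rewrite tri_cyc tri_alt. Qed.
Lemma tri_altm u v : tri u v u = 0.
Proof. by rewrite -tri_cyc tri_alt. Qed.

Lemma triDl u u' v w : tri (u + u') v w = tri u v w + tri u' v w.
Proof. by rewrite /tri linearDl formDl. Qed.
Lemma triDm u v v' w : tri u (v + v') w = tri u v w + tri u v' w.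
Proof. by rewrite /tri linearDr formDl. Qed.
Lemma triDr u v w w' : tri u v (w + w') = tri u v w + tri u v w'.
Proof. exact: formDr. Qed.
Lemma triZl a u v w : tri (a *: u) v w = a * tri u v w.
Proof. by rewrite /tri linearZl_LR formZl. Qed.
Lemma triZm a u v w : tri u (a *: v) w = a * tri u v w.
Proof. by rewrite /tri linearZr_LR formZl. Qed.
Lemma triZr a u v w : tri u v (a *: w) = a * tri u v w.
Proof. exact: formZr. Qed.
Lemma triNl u v w : tri (- u) v w = - tri u v w.
Proof. by rewrite -scaleN1r triZl mulN1r. Qed.
Lemma triNm u v w : tri u (- v) w = - tri u v w.
Proof. by rewrite -scaleN1r triZm mulN1r. Qed.
Lemma triNr u v w : tri u v (- w) = - tri u v w.
Proof. exact: formNr. Qed.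
Lemma tri0l v w : tri 0 v w = 0.
Proof. by rewrite -(scale0r 0) triZl mul0r. Qed.
Lemma tri0m v w : tri v 0 w = 0.
Proof. by rewrite tri_cyc -tri_cyc tri_swap tri0l oppr0. Qed.
Lemma tri0r v w : tri v w 0 = 0.
Proof. exact: form0r. Qed.
Lemma tri_suml I r (P : pred I) (f : I -> L) v w :
  tri (\sum_(i <- r | P i) f i) v w = \sum_(i <- r | P i) tri (f i) v w.
Proof. by rewrite /tri linear_sumlz form_suml. Qed.
Lemma tri_summ I r (P : pred I) (f : I -> L) v w :
  tri v (\sum_(i <- r | P i) f i) w = \sum_(i <- r | P i) tri v (f i) w.
Proof. by rewrite /tri linear_sumr form_suml. Qed.
Lemma tri_sumr I r (P : pred I) (f : I -> L) v w :
  tri v w (\sum_(i <- r | P i) f i) = \sum_(i <- r | P i) tri v w (f i).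
Proof. exact: form_sumr. Qed.

Definition triE := (triDl, triDm, triDr, triZl, triZm, triZr, triNl, triNm, triNr,
  tri0l, tri0m, tri0r).

Lemma form_inj u v : (forall w, '[u, w] = '[v, w]) -> u = v.
Proof.
move=> uv; apply/eqP; rewrite -subr_eq0; apply/eqP; apply: saa_form_nondeg => w.
by rewrite !formE uv subrr.
Qed.

(** * Orthogonal complements *)

Definition pairings n (X : nat -> L) : 'Hom(L, 'rV[F]_n) :=
  linfun (fun v => \row_(i < n) '[X i, v]).

Lemma pairingsE n X v i : pairings n X v 0 i = '[X i, v].
Proof.
have lin : linear (fun v : L => \row_(i < n) '[X i, v]).
  by move=> a u w; apply/rowP => j; rewrite !mxE !formE.
pose g : {linear L -> 'rV[F]_n} := HB.pack (fun v : L => \row_(i < n) '[X i, v])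
    (GRing.isLinear.Build _ _ _ _ _ lin).
by rewrite /pairings (lfunE g) mxE.
Qed.

Lemma dim_rowv n : \dim {:'rV[F]_n} = n.
Proof. by rewrite dimvf dim_matrix; apply: mul1n. Qed.

(** Pairing with a basis is injective, hence bijective onto coordinate space,
    by dimension. *)
Lemma riesz (f : {linear L -> F^o}) : exists u, forall v, '[v, u] = f v.
Proof.
set n := \dim {:L}; pose b := vbasis {:L}; pose g := pairings n (nth 0 b).
have ker0 : (lker g = 0)%VS.
  apply/eqP; rewrite -subv0; apply/subvP => u; rewrite memv_ker memv0 => /eqP/rowP u0.
  apply/eqP/saa_form_nondeg => v; rewrite (coord_vbasis (memvf v)) form_sumr.
  apply: big1 => i _; rewrite formZr formC -(pairingsE (n := n)) u0.
  by rewrite mxE oppr0 mulr0.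
have full : limg g = fullv.
  have dimg : \dim (limg g) = n by apply: limg_dim_eq; rewrite ker0 capv0.
  by apply/eqP; rewrite eqEdim subvf dimg dim_rowv leqnn.
have : \row_i f b`_i \in limg g by rewrite full; apply: memvf.
case/memv_imgP => u _ /rowP fu; exists u => v.
rewrite (coord_vbasis (memvf v)) form_suml linear_sum; apply: eq_bigr => i _.
by rewrite formZl linearZ -(pairingsE (n := n)) -fu mxE.
Qed.

Lemma riesz_free (X : seq L) (c : seq F) :
  free X -> size c = size X ->
  exists u, forall i, (i < size X)%N -> '[X`_i, u] = c`_i.
Proof.
move=> frX sz; have [f fX] := linear_of_free (rT := F^o) X c.
have [u uf] := riesz f; exists u => i lti.
by rewrite uf -(nth_map _ 0) // (fX frX sz).
Qed.

Definition perp U : {vspace L} := lker (pairings (\dim U) (nth 0 (vbasis U))).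

Lemma perpP U v : reflect (forall u, u \in U -> '[u, v] = 0) (v \in perp U).
Proof.
rewrite memv_ker; apply: (iffP eqP) => [/rowP v0 u uU | v0].
  rewrite (coord_vbasis uU) form_suml; apply: big1 => i _.
  by rewrite formZl -(pairingsE (n := \dim U)) v0 mxE mulr0.
by apply/rowP => i; rewrite pairingsE mxE v0 // vbasis_mem // mem_nth // size_tuple.
Qed.

Lemma dim_perp U : (\dim (perp U) + \dim U = \dim {:L})%N.
Proof.
rewrite /perp; set g := pairings _ _.
have full : limg g = fullv.
  apply/vspaceP => r; rewrite [in RHS]memvf.
  have [|u ur] := riesz_free (c := [seq r 0 i | i <- enum 'I_(\dim U)])
    (basis_free (vbasisP U)); first by rewrite size_map size_enum_ord size_tuple.
  apply/memv_imgP; exists u; rewrite ?memvf //; apply/rowP => i.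
  by rewrite pairingsE ur ?size_tuple // (nth_map i) ?size_enum_ord // nth_ord_enum.
by rewrite -(limg_ker_dim g fullv) capfv full dim_rowv.
Qed.

Lemma perpK U : perp (perp U) = U.
Proof.
apply/eqP; rewrite eq_sym eqEdim; apply/andP; split.
  apply/subvP => u uU; apply/perpP => v /perpP vU.
  by rewrite formC vU // oppr0.
rewrite -(leq_add2r (\dim (perp U))) dim_perp addnC.
by rewrite dim_perp.
Qed.

Lemma perpS U V : (U <= V)%VS -> (perp V <= perp U)%VS.
Proof.
move/subvP => UV; apply/subvP => v /perpP vV; apply/perpP => u /UV; exact: vV.
Qed.

Lemma sub_perpC U V : (U <= perp V)%VS -> (V <= perp U)%VS.
Proof. by move/perpS; rewrite perpK. Qed.

Lemma perp_prodvP U V w :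
  reflect (forall u v, u \in U -> v \in V -> tri u v w = 0)
          (w \in perp (saa_prodv U V)).
Proof.
apply: (iffP idP) => [/perpP w0 u v uU vV | w0].
  by apply: w0; have /saa_prodvP := subvv (saa_prodv U V); apply.
rewrite memvE; apply: sub_perpC; apply/saa_prodvP => u v uU vV; apply/perpP => t.
by case/vlineP => k ->; rewrite formZl formC -/(tri u v w) w0 // oppr0 mulr0.
Qed.

Lemma mem_prodv U V u v : u \in U -> v \in V -> u ** v \in saa_prodv U V.
Proof. by move: u v; apply/saa_prodvP/subvv. Qed.

Lemma prodvS U U' V V' :
  (U <= U')%VS -> (V <= V')%VS -> (saa_prodv U V <= saa_prodv U' V')%VS.
Proof.
move=> /subvP UU /subvP VV; apply/saa_prodvP => u v /UU uU /VV vV.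
exact: mem_prodv.
Qed.

(** The products [x u] vanish exactly when [x] is orthogonal to all [u v]. *)
Lemma center_perp : saa_center L = perp (saa_lower L 2).
Proof.
apply/vspaceP => x; apply/saa_centerP/perp_prodvP => [x0 u v _ _ | x0 u].
  by rewrite -tri_cyc /tri x0 form0l.
apply: saa_form_nondeg => v; rewrite -/(tri x u v) tri_cyc x0 ?memvf //.
Qed.
End Forms.

(** * Presentations and standard bases *)

Section Delta.
Variable F : fieldType.

Definition delta (a g : gen) : F := (g == a)%:R.

Definition det3 (a b c : gen) (u v w : gen -> F) : F :=
  u a * (v b * w c - v c * w b) - u b * (v a * w c - v c * w a)
  + u c * (v a * w b - v b * w a).

Definition entry_gens (p : gen * gen * gen * F) : seq gen :=
  [:: p.1.1.1; p.1.1.2; p.1.2].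

(** The alternating trilinear form prescribed by a presentation, on coordinate
    functions: each entry contributes a multiple of a 3-by-3 minor. *)
Definition pres_tri (P : presentation F) (u v w : gen -> F) : F :=
  \sum_(p <- P) p.2 * det3 p.1.1.1 p.1.1.2 p.1.2 u v w.

(** Different entries that are rearrangements of each other could prescribe
    conflicting values. *)
Definition pres_wf (P : presentation F) : bool :=
  all (fun p => uniq (entry_gens p)) P &&
  pairwise (fun p q => ~~ perm_eq (entry_gens p) (entry_gens q)) P.

Lemma det3_delta a b c :
  uniq [:: a; b; c] -> det3 a b c (delta a) (delta b) (delta c) = 1.
Proof.
rewrite /= !inE negb_or andbT => /andP[/andP[/negPf ab /negPf ac] /negPf bc].
rewrite /det3 /delta !eqxx (eq_sym b a) (eq_sym c a) (eq_sym c b) ab ac bc /=.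
by ring.
Qed.

Lemma det3_delta0 a b c a' b' c' : ~~ perm_eq [:: a; b; c] [:: a'; b'; c'] ->
  det3 a' b' c' (delta a) (delta b) (delta c) = 0.
Proof.
move=> nperm; have col0 g : g \notin [:: a; b; c] ->
    [/\ delta a g = 0, delta b g = 0 & delta c g = 0].
  rewrite !inE !negb_or /delta => /and3P[/negPf -> /negPf -> /negPf ->].
  by [].
rewrite /det3.
have [a'abc | /col0[-> -> ->]] := boolP (a' \in [:: a; b; c]); last by ring.
have [b'abc | /col0[-> -> ->]] := boolP (b' \in [:: a; b; c]); last by ring.
have [c'abc | /col0[-> -> ->]] := boolP (c' \in [:: a; b; c]); last by ring.
have [-> | a'b'] := eqVneq a' b'; first by ring.
have [-> | a'c'] := eqVneq a' c'; first by ring.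
have [-> | b'c'] := eqVneq b' c'; first by ring.
have u' : uniq [:: a'; b'; c'] by rewrite /= !inE negb_or a'b' a'c' b'c'.
have sub : {subset [:: a'; b'; c'] <= [:: a; b; c]}.
  by move=> g; rewrite in_cons in_cons mem_seq1 => /or3P[] /eqP ->.
case/negP: nperm; rewrite perm_sym; apply: uniq_perm => //.
  exact: leq_size_uniq u' sub _.
by have [] := uniq_min_size u' sub.
Qed.

Lemma pres_tri0 P a b c : (forall p, p \in P -> ~~ perm_eq [:: a; b; c] (entry_gens p)) ->
  pres_tri P (delta a) (delta b) (delta c) = 0.
Proof.
by move=> nP; rewrite /pres_tri big_seq big1 // => p /nP/det3_delta0 ->; rewrite mulr0.
Qed.

Lemma pres_tri_listed P a b c r : pres_wf P -> (a, b, c, r) \in P ->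
  pres_tri P (delta a) (delta b) (delta c) = r.
Proof.
elim: P => [|p P IHP] //= /andP[/= /andP[up uP] /andP[/allP pP wP]].
rewrite /pres_tri big_cons -/(pres_tri P _ _ _) inE => /predU1P[pE | abcP].
  move: up pP; rewrite -pE => up pP /=.
  by rewrite det3_delta // mulr1 pres_tri0 ?addr0.
rewrite IHP ?abcP /pres_wf ?uP // det3_delta0 ?mulr0 ?add0r // perm_sym.
exact: (pP _ abcP).
Qed.
End Delta.

Section StandardBasis.
Variables (F : fieldType) (L : saa F) (e : gen -> L).

(** On a standard basis these pairings are the coordinates of [u]. *)
Definition scoord (u : L) (g : gen) : F :=
  match g with inl i => '[u, e (inr i)] | inr i => '[e (inl i), u] end.

Hypothesis xx : forall i j, '[e (inl i), e (inl j)] = 0.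
Hypothesis yy : forall i j, '[e (inr i), e (inr j)] = 0.
Hypothesis xy : forall i j, '[e (inl i), e (inr j)] = (i == j)%:R.

Lemma scoord_basis g h : scoord (e g) h = (g == h)%:R.
Proof.
case: h g => [j|j] [i|i] /=; rewrite ?xy ?xx ?yy //.
by rewrite (eq_sym j i).
Qed.

Lemma scoord_sum (k : gen -> F) g : scoord (\sum_h k h *: e h) g = k g.
Proof.
transitivity (\sum_h k h * (h == g)%:R).
  case: g => [j|j]; rewrite /= ?form_suml ?form_sumr; apply: eq_bigr => h _;
  by rewrite ?formZl ?formZr -scoord_basis.
by rewrite (bigD1 g) //= eqxx mulr1 big1 ?addr0 // => h /negPf ->; rewrite mulr0.
Qed.

(** Ten vectors with the right Gram matrix are automatically free, since the
    dual vectors are among them, up to sign. *)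
Lemma gram_standard_basis : \dim {:L} = 10%N -> standard_basis e.
Proof.
move=> dimL; split=> //; rewrite basisEdim.
have card10 : size (codom e) = 10%N by rewrite size_codom card_sum !card_ord.
rewrite dimL card10 leqnn andbT; suff fr : free (codom e).
  by rewrite -(dimv_leqif_sup (subvf _)) (eqP fr) card10 dimL.
apply/(@freeP _ _ _ (codom_tuple e)) => k k0 i.
have sumE : \sum_i k i *: (codom_tuple e)`_i = \sum_h k (enum_rank h) *: e h.
  rewrite (reindex enum_rank) /=; last by apply: onW_bij; apply: enum_rank_bij.
  by apply: eq_bigr => h _; rewrite nth_image enum_rankK.
have := scoord_sum (fun h => k (enum_rank h)) (enum_val i).
rewrite -sumE k0 enum_valK => <-.
by case: (enum_val i) => j /=; rewrite ?form0l ?form0r.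
Qed.
End StandardBasis.

Definition presents (F : fieldType) (L : saa F) (e : gen -> L) (P : presentation F) :
    Prop :=
  [/\ standard_basis e,
      forall a b c r, (a, b, c, r) \in P -> '[e a ** e b, e c] = r
    & forall a b c, (forall a' b' c' r, (a', b', c', r) \in P ->
        ~~ perm_eq [:: a; b; c] [:: a'; b'; c']) -> '[e a ** e b, e c] = 0].

Section Expand.
Variables (F : fieldType) (L : saa F) (e : gen -> L).
Hypothesis se : standard_basis e.

Let xx i j : '[e (inl i), e (inl j)] = 0. Proof. by case: se. Qed.
Let yy i j : '[e (inr i), e (inr j)] = 0. Proof. by case: se. Qed.
Let xy i j : '[e (inl i), e (inr j)] = (i == j)%:R. Proof. by case: se. Qed.

(** The difference of the two sides is orthogonal to a spanning family. *)
Lemma scoordK u : \sum_g scoord e u g *: e g = u.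
Proof.
apply/eqP; rewrite -subr_eq0; set d := _ - _.
have d0 g : scoord e d g = 0.
  suff -> : scoord e d g = scoord e (\sum_h scoord e u h *: e h) g - scoord e u g.
    by rewrite (scoord_sum xx yy xy) subrr.
  by case: g => j; rewrite /= !formE.
apply/eqP/saa_form_nondeg => v.
have : v \in perp <[d]>%VS.
  have : v \in <<codom e>>%VS by case: se => /span_basis -> _ _ _; apply: memvf.
  apply/subvP/span_subvP => _ /codomP[g ->]; apply/perpP => _ /vlineP[k ->].
  rewrite formZl; case: g => j; last by have /= -> := d0 (inl j); rewrite mulr0.
  by rewrite formC; have /= -> := d0 (inr j); rewrite oppr0 mulr0.
by move/perpP; apply; apply: memv_line.
Qed.

Lemma form_scoord u v : '[u, v] = \sum_i (scoord e u (inl i) * scoord e v (inr i)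
  - scoord e u (inr i) * scoord e v (inl i)).
Proof.
rewrite -{1}(scoordK v) form_sumr big_sumType /= sumrB addrC; congr (_ + _).
  by apply: eq_bigr => i _; rewrite formZr mulrC.
rewrite -sumrN; apply: eq_bigr => i _.
by rewrite formZr (formC u) mulrN mulrC.
Qed.

Lemma tri_scoord u v w : tri u v w =
  \sum_a \sum_b \sum_c scoord e u a * scoord e v b * scoord e w c * tri (e a) (e b) (e c).
Proof.
rewrite -{1}(scoordK u) tri_suml; apply: eq_bigr => a _.
rewrite -{1}(scoordK v) tri_summ; apply: eq_bigr => b _.
rewrite -{1}(scoordK w) tri_sumr; apply: eq_bigr => c _.
by rewrite !triE; ring.
Qed.

(** One formula for [tri] on the basis covers the listed and the unlisted triples. *)
Lemma presents_tri (P : presentation F) : pres_wf P ->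
    (forall a b c, tri (e a) (e b) (e c) = pres_tri P (delta F a) (delta F b) (delta F
      c)) ->
  presents e P.
Proof.
move=> wfP triP; split=> // [a b c r abcP | a b c nP].
  by rewrite -/(tri _ _ _) triP (pres_tri_listed wfP abcP).
rewrite -/(tri _ _ _) triP pres_tri0 // => -[[[a' b'] c'] r] /= abcP.
exact: nP abcP.
Qed.
End Expand.

Lemma perm3_ind (T : eqType) (Q : T -> T -> T -> Prop) :
    (forall x y z, Q x y z -> Q y x z) -> (forall x y z, Q x y z -> Q z x y) ->
  forall a b c a' b' c', perm_eq [:: a; b; c] [:: a'; b'; c'] -> Q a' b' c' -> Q a b c.
Proof.
move=> swap cyc a b c a' b' c'.
rewrite perm_sym => /perm_consP[i [u [rotE /perm_consP[j [v [rotE' vc]]]]]] h.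
have {rotE vc rotE'} : [\/ [\/ [:: a'; b'; c'] = [:: a; b; c] | [:: a'; b'; c'] = [:: a;
  c; b]],
    [\/ [:: b'; c'; a'] = [:: a; b; c] | [:: b'; c'; a'] = [:: a; c; b]]
  | [\/ [:: c'; a'; b'] = [:: a; b; c] | [:: c'; a'; b'] = [:: a; c; b]]].
  have uE : a :: u = [:: a; b; c] \/ a :: u = [:: a; c; b].
    have szu : size u = 2%N by have := congr1 size rotE; rewrite size_rot => -[].
    move/perm_small_eq: vc rotE' => -> //.
    case: u szu {rotE} => [|u1 [|u2 []]] //= _.
    by case: j => [|[|j]]; rewrite /rot /= => -[-> ->]; auto.
  case: i rotE uE => [|[|[|i]]]; rewrite /rot /= => ->; try by [constructor 1 |
    constructor 2 | constructor 3].
by case=> -[] [? ? ?]; subst; auto.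
Qed.

(** Presentations determine the algebra: the linear map matching two standard
    bases is an isometry, and it preserves [tri] since alternation determines
    the values of [tri] on rearrangements of the listed triples. *)
Lemma has_presentation_iso (F : fieldType) (L M : saa F) (P : presentation F) :
  has_presentation L P -> has_presentation M P -> saa_iso L M.
Proof.
case=> e [se Pe Pe0] [e' [se' Pe' Pe0']].
have triE a b c : tri (e a) (e b) (e c) = tri (e' a) (e' b) (e' c).
  have [/hasP[[[[a' b'] c'] r] pP /= perm_abc] | /hasPn nP] := boolP
      (has (fun p => perm_eq [:: a; b; c] (entry_gens p)) P).
    apply: (perm3_ind (Q := fun a b c => tri (e a) (e b) (e c) = tri (e' a) (e' b) (e'
      c)))
      perm_abc _ => [x y z xyz | x y z xyz |].
    - by rewrite tri_swap xyz -tri_swap.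
    - by rewrite tri_cyc xyz -tri_cyc.
    - by rewrite /tri (Pe _ _ _ _ pP) (Pe' _ _ _ _ pP).
  by rewrite /tri Pe0 ?Pe0' // => a' b' c' r /nP.
pose f (K K' : saa F) (d : gen -> K) (d' : gen -> K') u := \sum_g scoord d u g *: d' g.
have lin (K K' : saa F) (d : gen -> K) (d' : gen -> K') : linear (f K K' d d').
  move=> k u v; rewrite /f scaler_sumr -big_split /=; apply: eq_bigr => g _.
  rewrite scalerA -scalerDl; congr (_ *: _).
  by case: g => j; rewrite /= !formE.
have fK (K K' : saa F) (d : gen -> K) (d' : gen -> K') :
    standard_basis d -> standard_basis d' -> cancel (f K K' d d') (f K' K d' d).
  move=> sd [_ xx yy xy] u; rewrite -[RHS](scoordK sd); apply: eq_bigr => g _.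
  by rewrite (scoord_sum xx yy xy).
have fcoord u g : scoord e' (f L M e e' u) g = scoord e u g.
  by case: (se') => _ xx yy xy; rewrite (scoord_sum xx yy xy).
have fform u v : '[f L M e e' u, f L M e e' v] = '[u, v].
  rewrite (form_scoord se) (form_scoord se'); apply: eq_bigr => i _.
  by rewrite !fcoord.
pose fl : {linear L -> M} := HB.pack (f L M e e') (GRing.isLinear.Build _ _ _ _ _ (lin _
  _ _ _)).
exists fl; split=> //; first by exists (f M L e' e); apply: fK.
move=> u v; apply: form_inj => w.
rewrite -[w](fK _ _ _ _ se' se) [LHS]fform -!/(tri _ _ _).
rewrite (tri_scoord se) (tri_scoord se'); do 3!apply: eq_bigr => ? _.
by rewrite !fcoord triE.
Qed.

(** * The algebra with a given presentation *)

Section PresAlg.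
Variables (F : fieldType) (P : presentation F).
Local Notation V := {ffun gen -> F^o}.
Implicit Types u v w : V.

Definition pform u v : F^o :=
  \sum_i (u (inl i) * v (inr i) - u (inr i) * v (inl i)).

(** The only product with [(u v, w) = pres_tri P u v w]: the coordinates of a
    vector are, up to sign, its pairings with the dual basis vectors. *)
Definition pmul u v : V := [ffun g => match g with
  | inl i => pres_tri P u v (delta F (inr i))
  | inr i => - pres_tri P u v (delta F (inl i)) end].

Lemma ffun_linE (k : F) u v g : (k *: u + v) g = (k : F) * (u g : F) + v g :> F.
Proof. by rewrite !ffunE. Qed.

Lemma pform_bilinear : bilinear_for *%R *%R pform.
Proof.
split=> [v k u u' | u k v v']; rewrite /pform /= mulr_sumr -big_split /=;
  by apply: eq_bigr => i _; rewrite !ffun_linE /=; ring.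
Qed.

Lemma pres_tri_linl k u u' (v w : gen -> F) :
  pres_tri P ((k *: u + u') : V) v w = k * pres_tri P u v w + pres_tri P u' v w.
Proof.
rewrite /pres_tri /det3 mulr_sumr -big_split /=.
by apply: eq_bigr => i _; rewrite !ffun_linE; ring.
Qed.

Lemma pres_tri_swap (u v w : gen -> F) : pres_tri P u v w = - pres_tri P v u w.
Proof. by rewrite /pres_tri /det3 -sumrN; apply: eq_bigr => i _; ring. Qed.

Lemma pres_tri_cyc (u v w : gen -> F) : pres_tri P u v w = pres_tri P v w u.
Proof. by rewrite /pres_tri /det3; apply: eq_bigr => i _; ring. Qed.

Lemma pres_tri_alt (u v : gen -> F) : pres_tri P u u v = 0.
Proof. by rewrite /pres_tri /det3; apply: big1 => i _; ring. Qed.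

Lemma pmul_bilinear : bilinear_for *:%R *:%R pmul.
Proof.
split=> [v k u u' | u k v v']; apply/ffunP => -[i|i]; rewrite ffun_linE !ffunE /=.
- exact: pres_tri_linl.
- by rewrite pres_tri_linl; ring.
- by rewrite pres_tri_swap pres_tri_linl (pres_tri_swap v) (pres_tri_swap v'); ring.
- by rewrite pres_tri_swap pres_tri_linl (pres_tri_swap v) (pres_tri_swap v'); ring.
Qed.

Lemma pform_alt u : pform u u = 0.
Proof. by apply: big1 => i _; ring. Qed.

Definition unitv g : V := [ffun h => delta F g h].

Lemma pform_unitl u i : pform (unitv (inl i)) u = u (inr i).
Proof.
rewrite /pform (bigD1 i) //= big1 => [|j ji]; rewrite !ffunE /delta /= ?eqxx.
  by rewrite addr0 mul0r subr0; apply: mul1r.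
have -> : (inl j == inl i :> gen) = false by apply/negbTE.
by rewrite !mul0r subr0.
Qed.

Lemma pform_unitr u i : pform (unitv (inr i)) u = - u (inl i).
Proof.
rewrite /pform (bigD1 i) //= big1 => [|j ji]; rewrite !ffunE /delta /= ?eqxx.
  by rewrite addr0 mul0r sub0r; congr (- _); apply: mul1r.
have -> : (inr j == inr i :> gen) = false by apply/negbTE.
by rewrite !mul0r subr0.
Qed.

Lemma pform_nondeg u : (forall v, pform u v = 0) -> u = 0.
Proof.
have pC v w : pform v w = - pform w v.
  by rewrite /pform -sumrN; apply: eq_bigr => i _; ring.
move=> u0; apply/ffunP => -[i|i]; rewrite !ffunE.
  by have := u0 (unitv (inr i)); rewrite pC pform_unitr opprK.
by have /eqP := u0 (unitv (inl i)); rewrite pC pform_unitl oppr_eq0 => /eqP.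
Qed.

Lemma pres_tri_sumr (u v : gen -> F) (w : V) :
  pres_tri P u v w = \sum_g w g * pres_tri P u v (delta F g).
Proof.
have wE g : w g = \sum_h w h * delta F h g.
  rewrite (bigD1 g) //= /delta eqxx mulr1 big1 ?addr0 // => h hg.
  by rewrite eq_sym (negPf hg) mulr0.
rewrite /pres_tri; under [RHS]eq_bigr do rewrite mulr_sumr.
rewrite exchange_big /=; apply: eq_bigr => -[[[a b] c] r] _ /=.
transitivity (r * ((u a * v b - u b * v a) * (\sum_h w h * delta F h c)
  - (u a * v c - u c * v a) * (\sum_h w h * delta F h b)
  + (u b * v c - u c * v b) * (\sum_h w h * delta F h a))).
  by rewrite -!wE /det3; ring.
rewrite !mulr_sumr -sumrB -big_split /= mulr_sumr; apply: eq_bigr => g _.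
by rewrite /det3; ring.
Qed.

Lemma pform_pmul u v w : pform (pmul u v) w = pres_tri P u v w.
Proof.
rewrite pres_tri_sumr big_sumType /= /pform -big_split /=.
by apply: eq_bigr => i _; rewrite !ffunE; ring.
Qed.

HB.instance Definition _ :=
  bilinear_isBilinear.Build F V V F^o _ _ pform pform_bilinear.
HB.instance Definition _ :=
  bilinear_isBilinear.Build F V V V _ _ pmul pmul_bilinear.

Lemma pmul_alt u : pmul u u = 0.
Proof. by apply/ffunP => -[i|i]; rewrite !ffunE pres_tri_alt ?oppr0. Qed.

Lemma pmul_cyc u v w : pform (pmul u v) w = pform (pmul v w) u.
Proof. by rewrite !pform_pmul pres_tri_cyc. Qed.

Definition pres_alg : saa F :=
  @SAA F V pform pmul pform_alt pform_nondeg pmul_alt pmul_cyc.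

Lemma dim_pres_alg : \dim {:pres_alg} = 10%N.
Proof.
rewrite dimvf; transitivity (#|gen| * 1)%N => //.
by rewrite card_sum !card_ord.
Qed.

Lemma pres_alg_presents : pres_wf P -> presents (unitv : gen -> pres_alg) P.
Proof.
move=> wfP; apply: (@presents_tri _ pres_alg unitv) => // [|a b c].
  apply: gram_standard_basis; last exact: dim_pres_alg.
  - by move=> i j; rewrite [LHS]pform_unitl !ffunE.
  - by move=> i j; rewrite [LHS]pform_unitr !ffunE; apply: oppr0.
  - by move=> i j; rewrite [LHS]pform_unitl !ffunE.
rewrite [LHS]pform_pmul /pres_tri /det3; apply: eq_bigr => p _.
by rewrite !ffunE.
Qed.

End PresAlg.

(** * The second center and the core *)

Section Structure.
Variables (F : fieldType) (L : saa F).
Implicit Types (u v w x z : L) (U V W : {vspace L}).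

(** This is [L^2] ([central_orthE]), in the form in which membership is tested by
    pairing with central elements. *)
Definition central_orth : {vspace L} := perp (saa_center L).
(** This is the second term of the upper central series ([second_centerP]). *)
Definition second_center : {vspace L} := perp (saa_lower L 3).
Definition core : {vspace L} := perp (saa_prodv central_orth central_orth).

Local Notation Z := (saa_center L).
Local Notation D := central_orth.
Local Notation K := second_center.
Local Notation H := core.

Lemma lowerS m : saa_lower L m.+2 = saa_prodv (saa_lower L m.+1) fullv.
Proof. by []. Qed.

Lemma lower_sub m n : (m <= n)%N -> (saa_lower L n.+1 <= saa_lower L m.+1)%VS.
Proof.
have step k : (saa_lower L k.+2 <= saa_lower L k.+1)%VS.
  elim: k => [|k IHk]; first exact: subvf.
  by rewrite !(lowerS k.+1) lowerS; apply: prodvS => //; apply: subvv.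
elim: n => [|n IHn]; first by rewrite leqn0 => /eqP ->; apply: subvv.
rewrite leq_eqVlt => /orP[/eqP -> | /IHn]; first exact: subvv.
exact: subv_trans.
Qed.

Lemma central_orthE : D = saa_lower L 2.
Proof. by rewrite /central_orth center_perp perpK. Qed.

Lemma form_mulr u x v : '[u, x ** v] = tri u v x.
Proof. by rewrite formC -/(tri x v u) 2!tri_cyc tri_swapr opprK. Qed.

Lemma second_centerP x : reflect (forall v, x ** v \in Z) (x \in K).
Proof.
rewrite /second_center lowerS; apply: (iffP (perp_prodvP _ _ _)) => x0 => [v | u v uL _].
  by rewrite center_perp; apply/perpP => u uL; rewrite form_mulr x0 ?memvf.
by have := x0 v; rewrite center_perp => /perpP/(_ u uL); rewrite form_mulr.
Qed.

Lemma tri_second13 x u v : x \in K -> u \in D -> tri x v u = 0.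
Proof. by move=> /second_centerP xK /perpP uD; apply: uD. Qed.

Lemma tri_second31 x u v : x \in K -> u \in D -> tri u v x = 0.
Proof. by move=> xK uD; rewrite 2!tri_cyc tri_swapr tri_second13 ?oppr0. Qed.

Lemma tri_second12 x u v : x \in K -> u \in D -> tri x u v = 0.
Proof. by move=> xK uD; rewrite tri_swapr tri_second13 ?oppr0. Qed.

Lemma tri_core3 u v y : u \in D -> v \in D -> y \in H -> tri u v y = 0.
Proof. by move=> uD vD /perp_prodvP; apply. Qed.

Lemma tri_core2 u v y : u \in D -> v \in D -> y \in H -> tri u y v = 0.
Proof. by move=> uD vD yH; rewrite tri_swapr tri_core3 ?oppr0. Qed.

Lemma center_sub_second : (Z <= K)%VS.
Proof. by apply/subvP => z /saa_centerP z0; apply/second_centerP => v; rewrite z0 mem0v.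
  Qed.

Lemma dim_addv_line U v : v \notin U -> \dim (U + <[v]>)%VS = (\dim U).+1.
Proof.
move=> vU; have v0 : v != 0 by apply: contraNneq vU => ->; apply: mem0v.
rewrite dimv_disjoint_sum ?dim_vline ?v0 ?addn1 //.
apply/eqP; rewrite -subv0; apply/subvP => u /memv_capP[kvU /vlineP[k kv]].
move: kvU; rewrite kv memv0; have [-> | k0] := eqVneq k 0; first by rewrite scale0r.
by move/(memvZ k^-1); rewrite scalerA mulVf // scale1r (negPf vU).
Qed.

(** Two elements whose multiplication maps take values in the same plane have
    proportional multiplication maps: an alternating form whose image is
    contained in a plane factors through the two coordinates dual to it, and
    alternating forms in two coordinates are unique up to a scalar. *)
Lemma proportional_muls U a w : \dim U = 2%N ->
    (forall v, a ** v \in U) -> (forall v, w ** v \in U) ->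
  exists c d : F, [/\ d *: a - c *: w \in Z,
    c = 0 -> a \in Z & d = 0 -> w \in Z].
Proof.
move=> dimU aU wU; pose X : seq L := vbasis U.
have szX : size X = 2%N by rewrite size_tuple.
have frX : free X := basis_free (vbasisP U).
have [b bX] := riesz_free (c := [:: 1; 0]) frX (esym szX).
have [c cX] := riesz_free (c := [:: 0; 1]) frX (esym szX).
rewrite szX in bX cX.
have UX u : u \in U -> exists r s, u = r *: X`_0 + s *: X`_1.
  have -> : (u \in U) = (u \in <<X>>%VS) by rewrite (span_basis (vbasisP U)).
  case: (X) szX => [|x0 [|x1 []]] //= _.
  rewrite span_cons span_seq1 => /memv_addP[_ /vlineP[r ->] [_ /vlineP[s ->] ->]].
  by exists r, s.
have triU t v v' : (forall v, t ** v \in U) -> tri t v v' =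
    ('[X`_0, v] * '[X`_1, v'] - '[X`_1, v] * '[X`_0, v']) * tri t b c.
  move=> tU.
  have red p q : tri t p q = '[X`_0, q] * tri t p b + '[X`_1, q] * tri t p c.
    have [r [s tp]] := UX _ (tU p).
    rewrite /tri tp !formE (bX 0%N) // (bX 1%N) // (cX 0%N) // (cX 1%N) //=.
    by ring.
  rewrite red !(tri_swapr t v) !(red _ v) !tri_altr (tri_swapr t c b).
  by ring.
have ZP t : (forall v, t ** v \in U) -> tri t b c = 0 -> t \in Z.
  move=> tU t0; apply/saa_centerP => v; apply: saa_form_nondeg => v'.
  by rewrite -/(tri t v v') triU // t0 mulr0.
exists (tri a b c), (tri w b c); split; [apply: ZP | exact: ZP | exact: ZP].
- move=> v; rewrite linearDl linearNl !linearZl_LR.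
  by apply: memvB; apply: memvZ.
- by rewrite !triE; ring.
Qed.

(** What remains of a standard basis modulo the center. The last field says that
    [y3], [y4], [y5] span the dual space of [Z], that is, span [L] modulo [D]. *)
Record frame (x1 x2 y1 y2 y3 y4 y5 : L) : Prop := Frame {
  frame_x1 : x1 \in K; frame_x2 : x2 \in K;
  frame_y1 : y1 \in D; frame_y2 : y2 \in D;
  frame_11 : '[x1, y1] = 1; frame_12 : '[x1, y2] = 0;
  frame_21 : '[x2, y1] = 0; frame_22 : '[x2, y2] = 1; frame_yy : '[y1, y2] = 0;
  frame_y3 : y3 \in H; frame_y4 : y4 \in H; frame_y5 : tri y1 y2 y5 = 1;
  frame_dual : forall z, z \in Z -> '[z, y3] = 0 -> '[z, y4] = 0 -> '[z, y5] = 0 -> z = 0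
}.

(** The values of [tri] on a frame that are not forced by its definition. *)
Definition frame_vals (x1 x2 y1 y2 y3 y4 y5 : L) : seq F :=
  [:: tri x1 y3 y4; tri x2 y3 y4; tri y1 y3 y4; tri y2 y3 y4;
      tri x1 y3 y5; tri x2 y3 y5; tri y1 y3 y5; tri y2 y3 y5;
      tri x1 y4 y5; tri x2 y4 y5; tri y1 y4 y5; tri y2 y4 y5; tri y3 y4 y5].

Section Class.
Hypothesis Lclass : in_class L.
Let nilL : saa_nilpotent L. Proof. by case: Lclass. Qed.
Let dimL : \dim {:L} = 10%N. Proof. by case: Lclass. Qed.
Let isoZ : saa_isotropic Z. Proof. by case: Lclass. Qed.
Let dimZ : \dim Z = 3%N. Proof. by case: Lclass. Qed.
Let dimL3 : \dim (saa_lower L 3) = 5%N. Proof. by case: Lclass. Qed.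

Lemma dim_central_orth : \dim D = 7%N.
Proof. by apply/eqP; rewrite -(eqn_add2r 3) -{1}dimZ dim_perp dimL. Qed.

Lemma dim_second_center : \dim K = 5%N.
Proof. by apply/eqP; rewrite -(eqn_add2r 5) -{1}dimL3 dim_perp dimL. Qed.

Lemma center_sub_orth : (Z <= D)%VS.
Proof. by apply/subvP => z zZ; apply/perpP => u uZ; apply: isoZ. Qed.

(** The last term of the lower central series that is not contained in [Z]
    consists of such elements, apart from those in [Z]. *)
Lemma ex_second_center : exists2 w, w \in K & (w \in D) && (w \notin Z).
Proof.
have exm : exists m, (saa_lower L m.+1 <= Z)%VS.
  by have [m Lm] := nilL; exists m; rewrite Lm sub0v.
case: (ex_minnP exm) => -[|[|m]] mZ min.
- by move: (dimvS mZ); rewrite dimZ /= dimL.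
- by move: (dimvS mZ); rewrite dimZ -central_orthE dim_central_orth.
have /subvPn[w wL wZ] : ~~ (saa_lower L m.+2 <= Z)%VS.
  by apply/negP => /min; rewrite ltnn.
exists w; last by rewrite wZ central_orthE (subvP (lower_sub (ltn0Sn m))).
by apply/second_centerP => v; apply: (subvP mZ); apply: mem_prodv; rewrite ?memvf.
Qed.

(** For [a] in [K] outside [D], both [a] and an element [w] of [K] and [D]
    multiply everything into the plane of those central elements which are
    orthogonal to [a], so some combination of the two is central, hence in
    [D]; this puts [a] in [D]. *)
Lemma second_center_sub_orth : (K <= D)%VS.
Proof.
apply/subvP => a aK; apply/negPn/negP => aD.
have [w wK /andP[wD wZ]] := ex_second_center.
pose U := perp (D + <[a]>)%VS.
have dimU : \dim U = 2%N.
  by apply/eqP; rewrite -(eqn_add2r (\dim (D + <[a]>))) dim_perp dim_addv_line //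
    dim_central_orth dimL.
have aU v : a ** v \in U.
  apply/perpP => u /memv_addP[d dD [t /vlineP[k ->] ->{u}]].
  by rewrite !formE !form_mulr tri_altm tri_second31 // mulr0 addr0.
have wU v : w ** v \in U.
  apply/perpP => u /memv_addP[d dD [t /vlineP[k ->] ->{u}]].
  by rewrite !formE !form_mulr (@tri_second31 w d v) // (@tri_second13 a w v) // mulr0
    addr0.
have [c [d [cd c0 d0]]] := proportional_muls dimU aU wU.
have dn0 : d != 0 by apply: contraNneq wZ => /d0.
case/negP: aD; rewrite -[a](scalerK dn0) memvZ // -[_ *: a](subrK (c *: w)).
by rewrite memvD ?memvZ // (subvP center_sub_orth).
Qed.

(** If [K] were not isotropic then [D] would be the sum of [K] and [L^3], so
    that [L^3 = D L] would lie in [Z + L^4]; multiplying by [L] once more,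
    [L^4 = L^5] would vanish and [L^3] be central, against the dimensions. *)
Lemma second_center_isotropic : (K <= perp K)%VS.
Proof.
apply/subvP => w3 w3K; apply/perpP => w1 w1K; apply/eqP/negPn/negP => w13.
have ZK z x : z \in Z -> x \in K -> '[z, x] = 0.
  by move=> zZ xK; have /perpP := subvP second_center_sub_orth _ xK; apply.
have w1Z : w1 \notin Z by apply: contraNN w13 => /ZK ->.
have w3Z1 : w3 \notin (Z + <[w1]>)%VS.
  apply: contraNN w13 => /memv_addP[z zZ [t /vlineP[k ->] ->]].
  by rewrite !formE saa_form_alt formC ZK // oppr0 mulr0 addr0.
have defK : K = (Z + <[w1]> + <[w3]>)%VS.
  apply/eqP; rewrite eq_sym eqEdim dim_second_center !dim_addv_line // dimZ leqnn andbT.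
  by rewrite !subv_add center_sub_second -!memvE w1K.
have capZ : (K :&: perp K <= Z)%VS.
  apply/subvP => u /memv_capP[]; rewrite [in X in X -> _]defK.
  case/memv_addP=> t /memv_addP[z zZ [t1 /vlineP[k ->] ->{t}]] [t2 /vlineP[l ->] ->{u}]
    /perpP uK.
  have := uK _ w1K; have := uK _ w3K.
  rewrite !formE !saa_form_alt (formC w1 z) (formC w3 z) !(ZK z) // (formC w3 w1).
  rewrite !mulr0 oppr0 !add0r addr0 mulrN => /eqP; rewrite oppr_eq0 !mulf_eq0 (negPf
    w13) orbF.
  move=> /eqP -> /eqP; rewrite mulf_eq0 (negPf w13) orbF => /eqP ->.
  by rewrite !scale0r !addr0.
have L3 : perp K = saa_lower L 3 by rewrite /second_center perpK.
have defD : (K + perp K)%VS = D.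
  apply/eqP; rewrite eqEdim subv_add second_center_sub_orth L3 central_orthE (lower_sub
    (isT : 1 <= 2)%N) /=.
  rewrite -central_orthE dim_central_orth -(leq_add2r (\dim (K :&: saa_lower L 3)))
    dimv_sum_cap dim_second_center dimL3.
  by rewrite -L3 (leq_add2l 7 _ 3) -dimZ dimvS.
have L3ZL4 : (saa_lower L 3 <= Z + saa_lower L 4)%VS.
  rewrite lowerS -central_orthE -defD L3; apply/saa_prodvP => _ v /memv_addP[x xK [y yL
    ->]] _.
  by rewrite linearDl memv_add ?(second_centerP _ xK) // mem_prodv ?memvf.
have L45 : (saa_lower L 4 <= saa_lower L 5)%VS.
  rewrite [saa_lower L 4]lowerS; apply/saa_prodvP => u v /(subvP L3ZL4)/memv_addP[z zZ
    [y yL ->]] _.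
  by rewrite linearDl (saa_centerP _ zZ) add0r mem_prodv ?memvf.
have L4m m : (saa_lower L 4 <= saa_lower L m.+4)%VS.
  elim: m => [|m IHm]; first exact: subvv.
  by apply: subv_trans L45 _; rewrite !lowerS prodvS ?subvv.
have [m Lm] := nilL; have L40 : saa_lower L 4 = 0%VS.
  apply/eqP; rewrite -subv0 -Lm (subv_trans (L4m m)) // lower_sub //.
  by rewrite -addn3 leq_addr.
by have := dimvS L3ZL4; rewrite L40 addv0 dimL3 dimZ.
Qed.

Lemma perp_second_center : perp K = K.
Proof.
apply/eqP; rewrite eq_sym eqEdim second_center_isotropic /= dim_second_center
  -(leq_add2r 5) -{1}dim_second_center.
by rewrite dim_perp dimL.
Qed.

Let KD := second_center_sub_orth.
Let ZK := center_sub_second.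
Let ZDiso z d : z \in Z -> d \in D -> '[z, d] = 0.
Proof. by move=> zZ /perpP; apply. Qed.

Lemma form_second_center u v : u \in K -> v \in K -> '[u, v] = 0.
Proof. by move=> uK vK; have /subvP/(_ v vK)/perpP := second_center_isotropic; apply. Qed.

(** The pairings with [y1] and [y2] show that [x1] and [x2] are independent modulo
    [Z], so that dimensions agree. *)
Lemma second_center_span x1 x2 y1 y2 : x1 \in K -> x2 \in K -> y1 \in D -> y2 \in D ->
    '[x1, y1] = 1 -> '[x1, y2] = 0 -> '[x2, y1] = 0 -> '[x2, y2] = 1 ->
  K = (Z + <[x1]> + <[x2]>)%VS.
Proof.
move=> x1K x2K y1D y2D x1y1 x1y2 x2y1 x2y2.
apply/eqP; rewrite eq_sym eqEdim !subv_add ZK -!memvE x1K x2K dim_second_center //=.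
rewrite !dim_addv_line ?dimZ //.
  apply/negP => /(ZDiso (d := y1))/(_ y1D)/eqP; rewrite x1y1; apply/negP; exact:
    oner_neq0.
apply/negP => /memv_addP[z zZ [t /vlineP[k ->] x2E]].
have /eqP := x2y2; rewrite x2E !formE ZDiso // x1y2 mulr0 addr0 eq_sym.
by rewrite (negPf (oner_neq0 _)).
Qed.

(** As [K] is its own orthogonal complement, [D] is spanned by [K], [y1] and [y2];
    products of elements of [K] with elements of [D] vanish, which leaves a
    2-by-2 minor. *)
Lemma tri_orth x1 x2 y1 y2 u v w : x1 \in K -> x2 \in K -> y1 \in D -> y2 \in D ->
    '[x1, y1] = 1 -> '[x1, y2] = 0 -> '[x2, y1] = 0 -> '[x2, y2] = 1 ->
    u \in D -> v \in D ->
  tri u v w = ('[x1, u] * '[x2, v] - '[x2, u] * '[x1, v]) * tri y1 y2 w.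
Proof.
move=> x1K x2K y1D y2D x1y1 x1y2 x2y1 x2y2.
have dec d : d \in D -> exists2 k, k \in K & d = k + ('[x1, d] *: y1 + '[x2, d] *: y2).
  move=> dD; exists (d - ('[x1, d] *: y1 + '[x2, d] *: y2)); last by rewrite subrK.
  rewrite -perp_second_center; apply/perpP => k.
  rewrite (second_center_span x1K x2K y1D y2D x1y1 x1y2 x2y1 x2y2).
  case/memv_addP=> t /memv_addP[z zZ [t1 /vlineP[a ->] ->{t}]] [t2 /vlineP[b ->] ->{k}].
  rewrite !formE !(ZDiso zZ) // x1y1 x1y2 x2y1 x2y2; ring.
move=> uD vD; have [k kK uE] := dec u uD; have [l lK vE] := dec v vD.
rewrite [in LHS]uE [in LHS]vE !triE.
have K0 a b c : a \in K -> b \in D -> tri a b c = 0.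
  by move=> aK bD; rewrite tri_swapr tri_second13 ?oppr0.
rewrite !(K0 k) ?(subvP KD l) // !(tri_swap _ l) !(K0 l) // !tri_alt (tri_swap y2 y1).
ring.
Qed.

(** The product [y1 y2] is central, because it is orthogonal to [D] by [tri_orth].
    Complete it to a basis of [Z] and let [y3], [y4], [y5] be dual to this basis,
    with [y5] dual to [y1 y2]: then [tri y1 y2] takes the values 0, 0, 1 on them. *)
Lemma ex_frame : exists x1 x2 y1 y2 y3 y4 y5, frame x1 x2 y1 y2 y3 y4 y5.
Proof.
have /subvPn[x1 x1K x1Z] : ~~ (K <= Z)%VS.
  by apply/negP => /dimvS; rewrite dim_second_center // dimZ.
have /subvPn[x2 x2K x2Z] : ~~ (K <= Z + <[x1]>)%VS.
  by apply/negP => /dimvS; rewrite dim_second_center // dim_addv_line // dimZ.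
(* Both [y1] and [y2] are required to be orthogonal to [Z], that is, to be in [D]. *)
pose X := x2 :: x1 :: vbasis Z.
have frX : free X.
  rewrite !free_cons (basis_free (vbasisP Z)) span_cons (span_basis (vbasisP Z)).
  by rewrite addvC x2Z x1Z.
have szX : size X = 5%N by rewrite /= size_tuple dimZ.
have [y1 y1X] := riesz_free (c := [:: 0; 1; 0; 0; 0]) frX (esym szX).
have [y2 y2X] := riesz_free (c := [:: 1; 0; 0; 0; 0]) frX (esym szX).
rewrite szX in y1X y2X.
have inD y a b : (forall i, (i < 5)%N -> '[X`_i, y] = [:: a; b; 0; 0; 0]`_i) -> y \in D.
  move=> yX; apply/perpP => z zZ; rewrite (coord_vbasis zZ) form_suml big1 // => i _.
  have := yX i.+2; rewrite formZl /= => ->; last by have := ltn_ord i; rewrite [X in (_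
    < X)%N]dimZ !ltnS.
  by case: (val i) => [|[|[|?]]] /=; rewrite ?nth_nil mulr0.
have y1D : y1 \in D := inD _ _ _ y1X.
have y2D : y2 \in D := inD _ _ _ y2X.
have x1y1 : '[x1, y1] = 1 by apply: (y1X 1%N).
have x2y1 : '[x2, y1] = 0 by apply: (y1X 0%N).
have x1y2 : '[x1, y2] = 0 by apply: (y2X 1%N).
have x2y2 : '[x2, y2] = 1 by apply: (y2X 0%N).
(* The correction makes [y1] and [y2] orthogonal. *)
pose y2' := y2 + '[y1, y2] *: x1.
have y2D' : y2' \in D by rewrite memvD ?memvZ ?(subvP KD x1).
have x1y2' : '[x1, y2'] = 0 by rewrite !formE saa_form_alt x1y2; ring.
have x2y2' : '[x2, y2'] = 1 by rewrite !formE (form_second_center x2K x1K) x2y2; ring.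
have yy : '[y1, y2'] = 0 by rewrite !formE (formC y1 x1) x1y1; ring.
have DD u v w := tri_orth (u := u) (v := v) w x1K x2K y1D y2D' x1y1 x1y2' x2y1 x2y2'.
pose z5 := y1 ** y2'.
have z5Z : z5 \in Z.
  rewrite -(perpK Z); apply/perpP => d dD.
  by rewrite form_mulr DD // tri_altm mulr0.
(* Otherwise [tri] would vanish whenever two arguments are in [D], and [D] would be
   contained in [K]. *)
have z50 : z5 != 0.
  apply/eqP => z50; have : (D <= K)%VS.
    apply/subvP => u uD; apply/second_centerP => v; rewrite -(perpK Z); apply/perpP => d
      dD.
    by rewrite form_mulr tri_swapr DD // /tri -/z5 z50 form0l mulr0 oppr0.
  by move/dimvS; rewrite dim_second_center // dim_central_orth.
have /subvPn[z4 z4Z z45] : ~~ (Z <= <[z5]>)%VS.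
  by apply/negP => /dimvS; rewrite dim_vline z50 dimZ.
have /subvPn[z3 z3Z z345] : ~~ (Z <= <[z5]> + <[z4]>)%VS.
  by apply/negP => /dimvS; rewrite dim_addv_line // dim_vline z50 dimZ.
have frz : free [:: z3; z4; z5].
  by rewrite !free_cons nil_free span_nil memv0 z50 !span_cons span_nil addv0 addvC z345
    z45.
have [y3 y3z] := riesz_free (c := [:: 1; 0; 0]) frz erefl.
have [y4 y4z] := riesz_free (c := [:: 0; 1; 0]) frz erefl.
have [y5 y5z] := riesz_free (c := [:: 0; 0; 1]) frz erefl.
have inH y : '[z5, y] = 0 -> y \in H.
  by move=> y0; apply/perp_prodvP => u v uD vD; rewrite DD // /tri y0 mulr0.
exists x1, x2, y1, y2', y3, y4, y5; split => //.
- by apply: inH; apply: (y3z 2%N).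
- by apply: inH; apply: (y4z 2%N).
- by apply: (y5z 2%N).
have defZ : Z = <<[:: z3; z4; z5]>>%VS.
  apply/eqP; rewrite eq_sym eqEdim (eqP frz) dimZ /= andbT.
  by apply/span_subvP => z; rewrite !inE => /or3P[] /eqP ->.
move=> z; rewrite {1}defZ !span_cons span_nil addv0.
case/memv_addP=> t /vlineP[a ->{t}] [_ /memv_addP[_ /vlineP[b ->] [_ /vlineP[c ->] ->]]
  ->{z}].
rewrite !formE (y3z 0%N) // (y3z 1%N) // (y3z 2%N) // (y4z 0%N) // (y4z 1%N) //.
rewrite (y4z 2%N) // (y5z 0%N) // (y5z 1%N) // (y5z 2%N) //= !mulr0 !mulr1 !add0r !addr0.
by move=> -> -> ->; rewrite !scale0r !addr0.
Qed.

(** * Changing the frame *)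

Section Moves.
Variables x1 x2 y1 y2 y3 y4 y5 : L.
Hypothesis fr : frame x1 x2 y1 y2 y3 y4 y5.

Lemma orth_sub_core : (D <= H)%VS.
Proof.
case: fr => x1K x2K y1D y2D x1y1 x1y2 x2y1 x2y2 _ _ _ _ _.
apply/subvP => w wD; apply/perp_prodvP => u v uD vD.
rewrite (tri_orth w x1K x2K y1D y2D) // tri_cyc.
by rewrite (tri_orth y1 x1K x2K y1D y2D) // tri_altm !mulr0.
Qed.

(** The substitution on [y1], [y2] is the one contragredient to that on [x1],
    [x2]; determinant 1 preserves [tri y1 y2 y5 = 1]. *)
Lemma frame_sl2 a b c d : a * d - b * c = 1 ->
  frame (a *: x1 + b *: x2) (c *: x1 + d *: x2) (d *: y1 - c *: y2)
    (a *: y2 - b *: y1) y3 y4 y5.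
Proof.
case: fr => x1K x2K y1D y2D x1y1 x1y2 x2y1 x2y2 yy y3H y4H t dual det1.
split=> //; rewrite ?(memvD, memvZ, memvN) //.
- by rewrite !formE x1y1 x1y2 x2y1 x2y2 -[RHS]det1; ring.
- by rewrite !formE x1y1 x1y2 x2y1 x2y2; ring.
- by rewrite !formE x1y1 x1y2 x2y1 x2y2; ring.
- by rewrite !formE x1y1 x1y2 x2y1 x2y2 -[RHS]det1; ring.
- by rewrite !formE !saa_form_alt (formC y2 y1) yy; ring.
- by rewrite !triE !tri_alt (tri_swap y2 y1) t -[RHS]det1; ring.
Qed.

Lemma frame_gl2 a b c d : a * d - b * c != 0 ->
  frame x1 x2 y1 y2 (a *: y3 + b *: y4) (c *: y3 + d *: y4) y5.
Proof.
case: fr => x1K x2K y1D y2D x1y1 x1y2 x2y1 x2y2 yy y3H y4H t dual det0.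
split=> //; rewrite ?(memvD, memvZ, memvN) // => z zZ; rewrite !formE => z3 z4.
apply: dual => //; apply: (mulfI det0); rewrite mulr0.
  transitivity (d * (a * '[z, y3] + b * '[z, y4]) - b * (c * '[z, y3] + d * '[z, y4])).
    by ring.
  by rewrite z3 z4; ring.
transitivity (a * (c * '[z, y3] + d * '[z, y4]) - c * (a * '[z, y3] + b * '[z, y4])).
  by ring.
by rewrite z3 z4; ring.
Qed.

Lemma frame_shift a b u v w : u \in D -> v \in D -> w \in D ->
  frame x1 x2 y1 y2 (y3 + u) (y4 + v) (y5 + a *: y3 + b *: y4 + w).
Proof.
move=> uD vD wD; have DH := subvP (orth_sub_core).
case: fr => x1K x2K y1D y2D x1y1 x1y2 x2y1 x2y2 yy y3H y4H t dual.
split=> //; try by rewrite memvD // DH.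
  by rewrite !triE t !(tri_core3 y1D y2D) // ?DH //; ring.
move=> z zZ; rewrite !formE (ZDiso zZ uD) (ZDiso zZ vD) (ZDiso zZ wD) !addr0 => z3 z4.
by rewrite z3 z4 !mulr0 !addr0; apply: dual.
Qed.

(** The symmetry of the coefficients keeps [y1] and [y2] orthogonal. *)
Lemma frame_sym a b c :
  frame x1 x2 (y1 + a *: x1 + b *: x2) (y2 + b *: x1 + c *: x2) y3 y4 y5.
Proof.
case: fr => x1K x2K y1D y2D x1y1 x1y2 x2y1 x2y2 yy y3H y4H t dual.
have x1D := subvP KD _ x1K; have x2D := subvP KD _ x2K.
split=> //; rewrite ?(memvD, memvZ) //.
- by rewrite !formE x1y1 !(form_second_center x1K) //; ring.
- by rewrite !formE x1y2 !(form_second_center x1K) //; ring.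
- by rewrite !formE x2y1 !(form_second_center x2K) //; ring.
- by rewrite !formE x2y2 !(form_second_center x2K) //; ring.
- rewrite !formE (formC y1 x1) (formC y1 x2) yy x1y1 x1y2 x2y1 x2y2.
  rewrite !(form_second_center x1K) // !(form_second_center x2K) //; ring.
- have K0 k d : k \in K -> d \in D -> tri k d y5 = 0 /\ tri d k y5 = 0.
    by move=> kK dD; rewrite (tri_swap d) tri_second12 // oppr0.
  rewrite !triE t !(proj1 (K0 x1 _ x1K _)) // !(proj1 (K0 x2 _ x2K _)) //.
  rewrite !(proj2 (K0 x1 _ x1K _)) // !(proj2 (K0 x2 _ x2K _)) //.
  ring.
Qed.

(** An element orthogonal to [D] is central, hence zero by [frame_dual] if it is
    also orthogonal to [y3], [y4], [y5]. *)
Lemma frame_full : <<[:: y3, y4, y5 & vbasis D]>>%VS = fullv.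
Proof.
case: fr => _ _ _ _ _ _ _ _ _ _ _ _ dual; set X := [:: y3, y4, y5 & _].
have perp0 : perp <<X>>%VS = 0%VS.
  apply/eqP; rewrite -subv0; apply/subvP => z /perpP z0.
  have Xz u : u \in X -> '[z, u] = 0 by move=> uX; rewrite formC z0 ?oppr0 // memv_span.
  rewrite memv0; apply/eqP/dual; try by apply: Xz; rewrite !inE eqxx ?orbT.
  rewrite -(perpK Z); apply/perpP => d dD; apply: z0.
  rewrite !span_cons (span_basis (vbasisP D)).
  by do 3!apply: (subvP (addvSr _ _)).
by apply/eqP; rewrite eqEdim subvf -(dim_perp <<X>>) perp0 dimv0 add0n leqnn.
Qed.

Lemma frame_coord v : exists a b c, v - (a *: y3 + b *: y4 + c *: y5) \in D.
Proof.
have : v \in <<[:: y3, y4, y5 & vbasis D]>>%VS by rewrite frame_full memvf.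
rewrite !span_cons (span_basis (vbasisP D)).
case/memv_addP=> t /vlineP[a ->{t}] [r /memv_addP[s /vlineP[b ->{s}]] [q]].
case/memv_addP=> s /vlineP[c ->{s}] [d dD ->{q}] ->{r} ->.
exists a, b, c; suff -> : a *: y3 + (b *: y4 + (c *: y5 + d)) - (a *: y3 + b *: y4 + c
  *: y5) = d by [].
by apply/eqP; rewrite subr_eq [d + _]addrC !addrA.
Qed.

Lemma frame_dual_basis : exists x3 x4 x5, [/\ x3 \in Z, x4 \in Z & x5 \in Z] /\
  [/\ [/\ '[x3, y3] = 1, '[x3, y4] = 0 & '[x3, y5] = 0],
      [/\ '[x4, y3] = 0, '[x4, y4] = 1 & '[x4, y5] = 0]
    & [/\ '[x5, y3] = 0, '[x5, y4] = 0 & '[x5, y5] = 1]].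
Proof.
have szX : size [:: y3, y4, y5 & vbasis D] = 10%N by rewrite /= size_tuple
  dim_central_orth.
have frX : free [:: y3, y4, y5 & vbasis D] by rewrite /free frame_full szX -dimL.
have ex (c : seq F) : size c = 3%N -> exists2 x, x \in Z &
    [/\ '[x, y3] = c`_0, '[x, y4] = c`_1 & '[x, y5] = c`_2].
  move=> szc; have [|x xX] := riesz_free (c := map -%R c ++ nseq 7 0) frX.
    by rewrite szX size_cat size_map szc.
  rewrite szX in xX.
  exists x; last first.
    have x0 := xX 0%N isT; have x1' := xX 1%N isT; have x2' := xX 2%N isT.
    case: c szc x0 x1' x2' {xX} => [|c0 [|c1 [|c2 []]]] //= _ x0 x1' x2'.
    by rewrite formC x0 formC x1' formC x2' !opprK.
  rewrite -(perpK Z); apply/perpP => d dD; rewrite (coord_vbasis dD) form_suml.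
  apply: big1 => i _; rewrite formZl -[(vbasis D)`_i]/([:: y3, y4, y5 & vbasis D]`_i.+3).
  rewrite xX; last by have := ltn_ord i; rewrite [X in (_ < X)%N]dim_central_orth.
  by rewrite nth_cat size_map szc nth_nseq if_same mulr0.
have [x3 x3Z x3y] := ex [:: 1; 0; 0] erefl.
have [x4 x4Z x4y] := ex [:: 0; 1; 0] erefl.
have [x5 x5Z x5y] := ex [:: 0; 0; 1] erefl.
by exists x3, x4, x5.
Qed.

(** The three values determine the multiplication map of an element of [K]; if
    they vanish then it is central, and orthogonal to [y1] and [y2]. *)
Lemma frame_nondeg a b :
    tri (a *: x1 + b *: x2) y3 y4 = 0 -> tri (a *: x1 + b *: x2) y3 y5 = 0 ->
    tri (a *: x1 + b *: x2) y4 y5 = 0 ->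
  a = 0 /\ b = 0.
Proof.
set x := a *: x1 + b *: x2.
case: (fr) => x1K x2K y1D y2D x1y1 x1y2 x2y1 x2y2 _ _ _ _ _.
have xK : x \in K by rewrite memvD ?memvZ.
move=> x34 x35 x45.
have xZ : x \in Z.
  clearbody x; apply/saa_centerP => v; apply: saa_form_nondeg => w; rewrite -/(tri x v w).
  have [a1 [b1 [c1]]] := frame_coord v; have [a2 [b2 [c2]]] := frame_coord w.
  set q := (X in w - X); set p := (X in v - X) => wD vD.
  have -> : tri x v w = tri x p q.
    rewrite -{1}(subrK p v) triDm (tri_second12 _ xK vD) add0r.
    by rewrite -{1}(subrK q w) triDr (tri_second13 _ xK wD) add0r.
  rewrite /p /q !triE !tri_altr (tri_swapr x y4 y3) (tri_swapr x y5 y3) (tri_swapr x y5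
    y4).
  by rewrite x34 x35 x45; ring.
by split; [have := ZDiso xZ y1D | have := ZDiso xZ y2D];
  rewrite !formE ?x1y1 ?x1y2 ?x2y1 ?x2y2 !(mulr0, mulr1, addr0, add0r).
Qed.
End Moves.

(** * Normal forms of frames *)

(** Adding combinations of [y1] and [y2] to [y3] and [y4] changes the values in
    question by multiples of [tri y1 y2 y5 = 1], and does not affect the others
    considered since [y3] and [y4] are in the core. *)
Lemma frame_clear x1 x2 y1 y2 y3 y4 y5 : frame x1 x2 y1 y2 y3 y4 y5 ->
  exists y3' y4', [/\ frame x1 x2 y1 y2 y3' y4' y5,
    tri y1 y3' y5 = 0 /\ tri y2 y3' y5 = 0,
    tri y1 y4' y5 = 0 /\ tri y2 y4' y5 = 0,
    forall d, d \in D -> tri d y3' y4' = tri d y3 y4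
  & forall x, x \in K -> tri x y3' y5 = tri x y3 y5 /\ tri x y4' y5 = tri x y4 y5].
Proof.
move=> fr; case: (fr) => x1K x2K y1D y2D _ _ _ _ _ y3H y4H t _.
pose u y := tri y2 y y5 *: y1 - tri y1 y y5 *: y2.
have uD y : u y \in D by rewrite memvB ?memvZ.
have := frame_shift fr 0 0 (uD y3) (uD y4) (mem0v _).
rewrite !scale0r !addr0 => fr'; exists (y3 + u y3), (y4 + u y4); split=> //.
- by rewrite !triE !tri_alt (tri_swap y2 y1) t; split; ring.
- by rewrite !triE !tri_alt (tri_swap y2 y1) t; split; ring.
- move=> d dD; have y4H' := frame_y4 fr'.
  by rewrite triDm (tri_core3 dD (uD y3) y4H') triDr (tri_core2 dD (uD y4) y3H) !addr0.
- by move=> x xK; split; rewrite triDm (tri_second12 _ xK (uD _)) addr0.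
Qed.

(** The case where [tri _ y3 y4] vanishes on [K]. Then non-degeneracy makes the
    matrix of the [tri x_i y_j y5] with [j = 3, 4] invertible, and a substitution
    on [y3], [y4] turns it into the identity. *)
Lemma normal_isotropic (x1 x2 y1 y2 y3 y4 y5 : L) :
    frame x1 x2 y1 y2 y3 y4 y5 -> tri x1 y3 y4 = 0 -> tri x2 y3 y4 = 0 ->
  exists s, exists x1 x2 y1 y2 y3 y4 y5 : L, frame x1 x2 y1 y2 y3 y4 y5 /\
    frame_vals x1 x2 y1 y2 y3 y4 y5 = [:: 0; 0; 0; s; 1; 0; 0; 0; 0; 1; 0; 0; 0].
Proof.
move=> fr x134 x234.
(* A substitution on [y1], [y2] puts [y1] in the kernel of [tri _ y3 y4]. *)
have {x1 x2 y1 y2 fr x134 x234} [x1 [x2 [y1 [y2 [fr x134 x234 y134]]]]] :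
    exists x1 x2 y1 y2 : L, [/\ frame x1 x2 y1 y2 y3 y4 y5, tri x1 y3 y4 = 0,
      tri x2 y3 y4 = 0 & tri y1 y3 y4 = 0].
  have [q0 | q0] := eqVneq (tri y2 y3 y4) 0.
    have det : 0 * 0 - 1 * -1 = 1 :> F by ring.
    do 4!eexists; split; first exact: (frame_sl2 fr det);
      rewrite !triE ?x134 ?x234 ?q0; ring.
  set q := tri y2 y3 y4 in q0; pose p := tri y1 y3 y4.
  have det : 1 * 1 - 0 * (p / q) = 1 :> F by ring.
  do 4!eexists; split; first exact: (frame_sl2 fr det);
    rewrite !triE ?x134 ?x234 -?/p -?/q; by field.
have {y3 y4 fr x134 x234 y134} [y3 [y4 [fr [x134 x234 y134] [x135 x145 x235 x245]]]] :
    exists y3 y4 : L, [/\ frame x1 x2 y1 y2 y3 y4 y5,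
      [/\ tri x1 y3 y4 = 0, tri x2 y3 y4 = 0 & tri y1 y3 y4 = 0]
    & [/\ tri x1 y3 y5 = 1, tri x1 y4 y5 = 0, tri x2 y3 y5 = 0 & tri x2 y4 y5 = 1]].
  pose a := tri x1 y3 y5; pose b := tri x1 y4 y5.
  pose c := tri x2 y3 y5; pose d := tri x2 y4 y5.
  have K0 r s : r * a + s * c = 0 -> r * b + s * d = 0 -> r = 0 /\ s = 0.
    by move=> r0 s0; apply: (frame_nondeg fr); rewrite !triE // x134 x234 !mulr0 addr0.
  pose D := a * d - b * c; have D0 : D != 0.
    apply/eqP => D0.
    have [c0 a0] : c = 0 /\ - a = 0 by apply: K0; [ring | rewrite -[RHS]oppr0 -D0 /D;
      ring].
    have [d0 b0] : d = 0 /\ - b = 0 by apply: K0; [rewrite -D0 /D; ring | ring].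
    have [] := K0 1 0; last by move/eqP; rewrite oner_eq0.
      by rewrite -[a]opprK a0; ring.
    by rewrite -[b]opprK b0; ring.
  have det : (d / D) * (a / D) - (- c / D) * (- b / D) != 0.
    by rewrite (_ : _ - _ = D^-1) ?invr_eq0 //; rewrite /D; field.
  exists ((d / D) *: y3 + (- c / D) *: y4), ((- b / D) *: y3 + (a / D) *: y4).
  split; first exact: frame_gl2 det.
    by split; rewrite !triE !tri_altr (tri_swapr _ y4) ?x134 ?x234 ?y134; ring.
  by split; rewrite !triE -/a -/b -/c -/d /D; field.
have [y3' [y4' [fr' [y135 y235] [y145 y245] D34 K5]]] := frame_clear fr.
case: (fr) => x1K x2K y1D y2D _ _ _ _ _ _ _ _ _.
have x1D := subvP KD _ x1K; have x2D := subvP KD _ x2K.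
case: (K5 x1 x1K) => x135' x145'; case: (K5 x2 x2K) => x235' x245'.
(* Since [tri x2 y4 y5 = 1], a multiple of [x2] added to [y3] clears [tri y3 y4 y5]. *)
exists (tri y2 y3' y4'), x1, x2, y1, y2.
exists (y3' - tri y3' y4' y5 *: x2), (y4' + 0), (y5 + 0 *: y3' + 0 *: y4' + 0).
have kD : - (tri y3' y4' y5 *: x2) \in D by rewrite memvN memvZ.
split; first exact: (frame_shift fr' _ _ kD (mem0v _) (mem0v _)).
rewrite !scale0r !addr0 /frame_vals !triE.
rewrite !(tri_second12 _ x2K x1D, tri_second12 _ x2K x2D, tri_second12 _ x2K y1D,
  tri_second12 _ x2K y2D).
rewrite !(tri_swap _ x2) !(tri_second12 _ x2K x1D, tri_second12 _ x2K x2D, tri_second12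
  _ x2K y1D, tri_second12 _ x2K y2D).
rewrite !D34 // x135' x235' x145' x245' x134 x234 y134 x135 x235 x145 x245 y135 y235
  y145 y245.
by congr [:: _; _; _; _; _; _; _; _; _; _; _; _; _]; ring.
Qed.

(** Scaling [x2], [y1] and [y3] by [N] and [x1], [y2] and [y4] by the inverse of
    [N] preserves the values 1 and divides [s] by [N]; here [N = - s]. *)
Lemma normal_rescale s (x1 x2 y1 y2 y3 y4 y5 : L) : s != 0 ->
    frame x1 x2 y1 y2 y3 y4 y5 ->
    frame_vals x1 x2 y1 y2 y3 y4 y5 = [:: 0; 0; 0; s; 1; 0; 0; 0; 0; 1; 0; 0; 0] ->
  exists x1 x2 y1 y2 y3 y4 y5 : L, frame x1 x2 y1 y2 y3 y4 y5 /\
    frame_vals x1 x2 y1 y2 y3 y4 y5 = [:: 0; 0; 0; -1; 1; 0; 0; 0; 0; 1; 0; 0; 0].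
Proof.
move=> s0 fr [v1 v2 v3 v4 v5 v6 v7 v8 v9 v10 v11 v12 v13].
have det1 : (- s^-1) * (- s) - 0 * 0 = 1 by field.
have det0 : (- s) * (- s^-1) - 0 * 0 != 0.
  by rewrite (_ : _ - _ = 1) ?oner_eq0 //; field.
do 7!eexists; split; first exact: (frame_gl2 (frame_sl2 fr det1) det0).
rewrite /frame_vals !triE !tri_altr !(tri_swapr _ y4 y3).
rewrite v1 v2 v3 v4 v5 v6 v7 v8 v9 v10 v11 v12 v13.
by congr [:: _; _; _; _; _; _; _; _; _; _; _; _; _]; field.
Qed.

(** The case where [tri _ y3 y4] does not vanish on [K]: its kernel in the span of
    [x1], [x2] is spanned by [x2], say, and [tri x2 y3 y5], [tri x2 y4 y5] do not
    both vanish by non-degeneracy. The value 1 of [tri x1 y3 y4] then serves to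
    clear most of the others. *)
Lemma normal_nonisotropic (x1 x2 y1 y2 y3 y4 y5 : L) :
    frame x1 x2 y1 y2 y3 y4 y5 -> (tri x1 y3 y4 != 0) || (tri x2 y3 y4 != 0) ->
  exists x1 x2 y1 y2 y3 y4 y5 : L, frame x1 x2 y1 y2 y3 y4 y5 /\
    frame_vals x1 x2 y1 y2 y3 y4 y5 = [:: 1; 0; 0; 0; 0; 0; 0; 0; 0; 1; 0; 0; 0].
Proof.
move=> fr x34.
have {x1 x2 y1 y2 fr x34} [x1 [x2 [y1 [y2 [fr x134 x234]]]]] :
    exists x1 x2 y1 y2 : L, [/\ frame x1 x2 y1 y2 y3 y4 y5, tri x1 y3 y4 != 0
      & tri x2 y3 y4 = 0].
  have [p0 | p0] := eqVneq (tri x1 y3 y4) 0.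
    move: x34; rewrite p0 eqxx /= => q0.
    have det : 0 * 0 - 1 * -1 = 1 :> F by ring.
    do 4!eexists; split; first exact: (frame_sl2 fr det); rewrite !triE p0.
      by rewrite mul0r add0r mul1r.
    by ring.
  set p := tri x1 y3 y4 in p0; pose q := tri x2 y3 y4.
  have det : 1 * 1 - 0 * (- q / p) = 1 :> F by ring.
  do 4!eexists; split; first exact: (frame_sl2 fr det); rewrite !triE -?/p -?/q.
    by rewrite mul1r mul0r addr0.
  by field.
have {y3 y4 fr x134 x234} [y3 [y4 [fr [x134 x234] [x235 x245]]]] :
    exists y3 y4 : L, [/\ frame x1 x2 y1 y2 y3 y4 y5,
      tri x1 y3 y4 = 1 /\ tri x2 y3 y4 = 0 & tri x2 y3 y5 = 0 /\ tri x2 y4 y5 = 1].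
  pose s := tri x1 y3 y4; pose c := tri x2 y3 y5; pose d := tri x2 y4 y5.
  have [d0 | d0] := eqVneq d 0.
    have c0 : c != 0.
      apply/eqP => c0; have [] := frame_nondeg (a := 0) (b := 1) fr;
        last by move=> _ /eqP; rewrite oner_eq0.
      + by rewrite !triE x234; ring.
      + by rewrite !triE -/c c0; ring.
      + by rewrite !triE -/d d0; ring.
    have det : 0 * 0 - (- c / s) * c^-1 != 0.
      by rewrite (_ : _ - _ = s^-1) ?invr_eq0 //; field; apply/andP.
    exists (0 *: y3 + (- c / s) *: y4), (c^-1 *: y3 + 0 *: y4).
    split; first exact: frame_gl2 det.
      rewrite !triE !tri_altr !(tri_swapr _ y4) x234 -/s.
      by split; [field; apply/andP | ring].
    by rewrite !triE -/c -/d d0; split; field.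
  have det : (d / s) * d^-1 - (- c / s) * 0 != 0.
    by rewrite (_ : _ - _ = s^-1) ?invr_eq0 //; field; apply/andP.
  exists ((d / s) *: y3 + (- c / s) *: y4), (0 *: y3 + d^-1 *: y4).
  split; first exact: frame_gl2 det.
    rewrite !triE !tri_altr !(tri_swapr _ y4) x234 -/s.
    by split; [field; apply/andP | ring].
  by rewrite !triE -/c -/d; split; field => //; apply/andP.
(* Multiples of [y3] and [y4] added to [y5] clear [tri x1 y3 y5] and [tri x1 y4 y5]. *)
have {y5 fr x235 x245} [y5 [fr x135 x145 x235 x245]] :
    exists y5 : L, [/\ frame x1 x2 y1 y2 y3 y4 y5, tri x1 y3 y5 = 0,
      tri x1 y4 y5 = 0, tri x2 y3 y5 = 0 & tri x2 y4 y5 = 1].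
  exists (y5 + tri x1 y4 y5 *: y3 + (- tri x1 y3 y5) *: y4); split.
  - rewrite -{1}(addr0 y3) -{1}(addr0 y4) -[X in frame _ _ _ _ _ _ X]addr0.
    exact: (frame_shift fr _ _ (mem0v _) (mem0v _) (mem0v _)).
  - by rewrite !triE !tri_altr x134; ring.
  - by rewrite !triE !tri_altr (tri_swapr _ y4 y3) x134; ring.
  - by rewrite !triE !tri_altr x234 x235; ring.
  - by rewrite !triE !tri_altr (tri_swapr _ y4 y3) x234 x245; ring.
(* Multiples of [x1] added to [y1] and [y2] clear [tri y1 y3 y4] and [tri y2 y3 y4];
   orthogonality of [y1] and [y2] then dictates a multiple of [x2] in [y1]. *)
have {y1 y2 fr} [y1 [y2 [fr y134 y234]]] : exists y1 y2 : L,
    [/\ frame x1 x2 y1 y2 y3 y4 y5, tri y1 y3 y4 = 0 & tri y2 y3 y4 = 0].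
  do 2!eexists; split; first exact: (frame_sym fr
    (- tri y1 y3 y4) (- tri y2 y3 y4) 0).
    by rewrite !triE x134 x234; ring.
  by rewrite !triE x134 x234; ring.
have [y3' [y4' [fr' [y135 y235] [y145 y245] D34 K5]]] := frame_clear fr.
case: (fr) => x1K x2K y1D y2D _ _ _ _ _ _ _ _ _.
have x1D := subvP KD _ x1K; have x2D := subvP KD _ x2K.
case: (K5 x1 x1K) => x135' x145'; case: (K5 x2 x2K) => x235' x245'.
(* Since [tri x1 y3 y4 = 1], a multiple of [x1] added to [y5] clears [tri y3 y4 y5]. *)
exists x1, x2, y1, y2.
exists (y3' + 0), (y4' + 0), (y5 + 0 *: y3' + 0 *: y4' + (- tri y3' y4' y5) *: x1).
have kD : (- tri y3' y4' y5) *: x1 \in D by rewrite memvZ.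
split; first exact: (frame_shift fr' _ _ (mem0v _) (mem0v _) kD).
rewrite !scale0r !addr0 /frame_vals !triE.
have KDr d y : d \in D -> tri d y x1 = 0 by move=> dD; rewrite 2!tri_cyc tri_second12.
rewrite !(KDr _ _ x1D, KDr _ _ x2D, KDr _ _ y1D, KDr _ _ y2D).
rewrite (tri_cyc y3' y4' x1) (tri_cyc y4' x1) !D34 //.
rewrite x135' x235' x145' x245' x134 x234 y134 y234 x135 x235 x145 x245 y135 y235 y145
  y245.
by congr [:: _; _; _; _; _; _; _; _; _; _; _; _; _]; ring.
Qed.
End Class.
End Structure.

(** * From frames to presentations *)

Section Alternating.
Variables (F : fieldType) (f : gen -> gen -> gen -> F) (s : seq gen).
Hypothesis f_swap : forall a b c, f a b c = - f b a c.
Hypothesis f_cyc : forall a b c, f a b c = f b c a.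
Hypothesis f_alt : forall a b, f a a b = 0.
Hypothesis f_out : forall a b c, a \notin s -> f a b c = 0.
Hypothesis f_sorted : forall i j k, (i < j)%N -> (j < k)%N -> (k < size s)%N ->
  f (nth (gx 1) s i) (nth (gx 1) s j) (nth (gx 1) s k) = 0.

Lemma alternating_eq0 a b c : f a b c = 0.
Proof.
have [/(nthP (gx 1))[i lti <-] | ?] := boolP (a \in s); last exact: f_out.
have [/(nthP (gx 1))[j ltj <-] | ?] := boolP (b \in s); last by rewrite f_cyc f_out.
have [/(nthP (gx 1))[k ltk <-] | ?] := boolP (c \in s); last by rewrite -f_cyc f_out.
have swap0 x y z : f x y z = 0 -> f y x z = 0 by move=> xyz; rewrite f_swap xyz oppr0.
have rot0 x y z : f x y z = 0 -> f z x y = 0 by move=> xyz; rewrite f_cyc.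
case: (ltngtP i j) => [ij | ji | ->]; last exact: f_alt.
  case: (ltngtP j k) => [jk | kj | ->]; last by rewrite f_cyc f_alt.
    by apply: f_sorted.
  case: (ltngtP i k) => [ik | ki | ->]; last by rewrite -f_cyc f_alt.
    by apply/swap0/rot0; apply: f_sorted.
  by apply/rot0/rot0; apply: f_sorted.
case: (ltngtP i k) => [ik | ki | ->]; last by rewrite -f_cyc f_alt.
  by apply: swap0; apply: f_sorted.
case: (ltngtP j k) => [jk | kj | ->]; last by rewrite f_cyc f_alt.
  by apply: rot0; apply: f_sorted.
by apply/swap0/rot0/rot0; apply: f_sorted.
Qed.
End Alternating.

Section Completion.
Variables (F : fieldType) (L : saa F).
Hypothesis Lclass : in_class L.
Variables x1 x2 y1 y2 y3 y4 y5 : L.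
Hypothesis fr : frame x1 x2 y1 y2 y3 y4 y5.
Local Notation Z := (saa_center L).

(** The members [x3], [x4], [x5] of a standard basis extending the frame are
    central; here they are replaced by 0. *)
Definition frame_gen (g : gen) : L := match g with
  | inl i => nth 0 [:: x1; x2] i
  | inr i => nth 0 [:: y1; y2; y3; y4; y5] i end.

(** Let [x3], [x4], [x5] be the basis of [Z] dual to [y3], [y4], [y5]. Adding
    combinations of these to the frame makes its members pair correctly with
    [y3], [y4], [y5], and changes no pairing between elements of [D]. *)
Lemma frame_completion : exists2 e : gen -> L, standard_basis e &
  forall g, e g - frame_gen g \in Z.
Proof.
have [_ dimL _ _ _] := Lclass.
have [x3 [x4 [x5 [[x3Z x4Z x5Z] dual]]]] := frame_dual_basis Lclass fr.
case: (fr) => x1K x2K y1D y2D x1y1 x1y2 x2y1 x2y2 y1y2 _ _ _ _.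
have KD := subvP (second_center_sub_orth Lclass).
have x1D := KD _ x1K; have x2D := KD _ x2K; have ZD := subvP (center_sub_orth Lclass).
have x1x2 : '[x1, x2] = 0.
  exact: (form_second_center Lclass).
have ZDl z d : z \in Z -> d \in central_orth L -> '[z, d] = 0 by move=> zZ /perpP; apply.
have ZDr z d : z \in Z -> d \in central_orth L -> '[d, z] = 0.
  by move=> zZ dD; rewrite formC ZDl ?oppr0.
have neg (u v : L) (k : F) : '[u, v] = k -> '[v, u] = - k by move=> <-; exact: formC.
case: dual => -[x3y3 x3y4 x3y5] [x4y3 x4y4 x4y5] [x5y3 x5y4 x5y5].
pose c u := u - ('[u, y3] *: x3 + '[u, y4] *: x4 + '[u, y5] *: x5).
pose y4' := y4 + '[y3, y4] *: x3.
pose y5' := y5 + ('[y3, y5] *: x3 + '[y4, y5] *: x4).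
pose e (g : gen) : L := match g with
  | inl i => nth 0 [:: c x1; c x2; x3; x4; x5] i
  | inr i => nth 0 [:: c y1; c y2; y3; y4'; y5'] i end.
have cZ u : c u - u \in Z.
  by rewrite /c addrAC subrr add0r memvN !memvD ?memvZ.
exists e; last first.
  by case=> -[[|[|[|[|[|i]]]]] // lti] /=; rewrite ?cZ ?subr0 ?subrr ?mem0v //;
    rewrite addrAC subrr add0r ?memvD ?memvZ.
have zz z z' : z \in Z -> z' \in Z -> '[z, z'] = 0 by move=> zZ /ZD; apply: ZDl.
have cz u z : u \in central_orth L -> z \in Z -> '[c u, z] = 0.
  by move=> uD zZ; rewrite /c !formE (ZDr _ _ zZ uD) !(zz _ z) // !mulr0 !addr0 oppr0
    addr0.
have zc u z : u \in central_orth L -> z \in Z -> '[z, c u] = 0.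
  by move=> uD zZ; rewrite formC cz ?oppr0.
have cc u v : u \in central_orth L -> v \in central_orth L -> '[c u, c v] = '[u, v].
  move=> uD vD; rewrite -[c v in LHS](subrK v) formDr cz // add0r.
  by rewrite /c !formE (ZDl x3 v) // (ZDl x4 v) // (ZDl x5 v) //; ring.
have cy3 u : '[c u, y3] = 0 by rewrite /c !formE x3y3 x4y3 x5y3; ring.
have cy4 u : u \in central_orth L -> '[c u, y4'] = 0.
  by move=> uD; rewrite formDr formZr (cz u x3) // /c !formE x3y4 x4y4 x5y4; ring.
have cy5 u : u \in central_orth L -> '[c u, y5'] = 0.
  by move=> uD; rewrite !formDr !formZr (cz u x3) // (cz u x4) // /c !formE x3y5 x4y5
    x5y5; ring.
have y34 : '[y3, y4'] = 0 by rewrite !formE (neg _ _ _ x3y3); ring.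
have y35 : '[y3, y5'] = 0 by rewrite !formE (neg _ _ _ x3y3) (neg _ _ _ x4y3); ring.
have y45 : '[y4', y5'] = 0.
  rewrite !formE (neg _ _ _ x3y4) (neg _ _ _ x4y4) x3y5 (zz x3 x3) // (zz x3 x4) //.
  by ring.
have zy4 z : z \in Z -> '[z, y4'] = '[z, y4] by move=> zZ; rewrite !formE (zz z x3) //;
  ring.
have zy5 z : z \in Z -> '[z, y5'] = '[z, y5] by move=> zZ; rewrite !formE (zz z x3) //
  (zz z x4) //; ring.
have alt0 u : '[u, u] = 0 := saa_form_alt u.
have antisym u v : '[u, v] = 0 -> '[v, u] = 0 by rewrite formC => /eqP; rewrite oppr_eq0
  => /eqP.
clearbody c y4' y5'.
apply: gram_standard_basis => //.
- move=> [[|[|[|[|[|i]]]]] //= lti] [[|[|[|[|[|j]]]]] //= ltj];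
    by [rewrite cc // ?alt0 // antisym | rewrite cz | rewrite zc | rewrite zz].
- move=> [[|[|[|[|[|i]]]]] //= lti] [[|[|[|[|[|j]]]]] //= ltj];
    by [rewrite cc // ?alt0 // antisym | rewrite ?cy3 ?cy4 ?cy5 ?alt0
      | apply: antisym; rewrite ?cy3 ?cy4 ?cy5].
- by move=> [[|[|[|[|[|i]]]]] //= lti] [[|[|[|[|[|j]]]]] //= ltj];
    rewrite /eq_op /= ?cc ?zc ?cy3 ?cy4 ?cy5 ?zy4 ?zy5.
Qed.
End Completion.

Section FramePresentation.
Variables (F : fieldType) (L : saa F).

(** The presentation of an algebra with a frame whose values are [v]. *)
Definition frame_pres (v : seq F) : presentation F :=
  [:: (gx 1, gy 3, gy 4, v`_0); (gx 2, gy 3, gy 4, v`_1); (gy 1, gy 3, gy 4, v`_2);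
      (gy 2, gy 3, gy 4, v`_3); (gx 1, gy 3, gy 5, v`_4); (gx 2, gy 3, gy 5, v`_5);
      (gy 1, gy 3, gy 5, v`_6); (gy 2, gy 3, gy 5, v`_7); (gx 1, gy 4, gy 5, v`_8);
      (gx 2, gy 4, gy 5, v`_9); (gy 1, gy 4, gy 5, v`_10); (gy 2, gy 4, gy 5, v`_11);
      (gy 3, gy 4, gy 5, v`_12); (gy 1, gy 2, gy 5, 1)].

Definition frame_gens : seq gen := [:: gx 1; gx 2; gy 1; gy 2; gy 3; gy 4; gy 5].

Hypothesis Lclass : in_class L.
Variables x1 x2 y1 y2 y3 y4 y5 : L.
Hypothesis fr : frame x1 x2 y1 y2 y3 y4 y5.
Local Notation fg := (frame_gen x1 x2 y1 y2 y3 y4 y5).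
Local Notation vals := (frame_vals x1 x2 y1 y2 y3 y4 y5).

(** Both sides are alternating in the generators, so it suffices to compare them
    on increasing triples among the seven generators of the frame. *)
Lemma frame_tri a b c : tri (fg a) (fg b) (fg c) =
  pres_tri (frame_pres vals) (delta F a) (delta F b) (delta F c).
Proof.
apply/eqP; rewrite -subr_eq0; apply/eqP; move: a b c.
pose f a b c := tri (fg a) (fg b) (fg c) -
  pres_tri (frame_pres vals) (delta F a) (delta F b) (delta F c).
apply: (@alternating_eq0 F f frame_gens).
- by move=> a b c; rewrite /f tri_swap pres_tri_swap opprB opprK addrC.
- by move=> a b c; rewrite /f tri_cyc pres_tri_cyc.
- by move=> a b; rewrite /f tri_alt pres_tri_alt subrr.
- move=> a b c aout; rewrite /f pres_tri0 ?subr0; last first.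
    have /allP sub : all (fun p => all (mem frame_gens) (entry_gens p)) (frame_pres
      vals) by [].
    move=> p /sub/allP psub; apply: contra aout => /perm_mem/(_ a).
    by rewrite mem_head => /esym/psub.
  suff -> : fg a = 0 by rewrite tri0l.
  by move: aout; case: a => -[[|[|[|[|[|i]]]]] // lti].
case: (fr) => x1K x2K y1D y2D _ _ _ _ _ y3H y4H y125 _.
have KD := subvP (second_center_sub_orth Lclass).
have x1D := KD _ x1K; have x2D := KD _ x2K.
have y2H := subvP (orth_sub_core Lclass fr) _ y2D.
move=> [|[|[|[|[|[|[|i]]]]]]] [|[|[|[|[|[|[|j]]]]]]] [|[|[|[|[|[|[|k]]]]]]] //= _ _ _;
  rewrite /f /pres_tri !big_cons big_nil /= ?det3_delta // ?det3_delta0 //;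
  rewrite ?mulr0 ?mulr1 ?addr0 ?add0r ?subr0 ?subrr //;
  try by rewrite tri_second12.
all: rewrite ?y125 ?subrr ?tri_core3 //.
Qed.

Lemma frame_has_presentation (P : presentation F) : pres_wf P ->
    (forall u v w, pres_tri (frame_pres vals) u v w = pres_tri P u v w) ->
  has_presentation L P.
Proof.
move=> wfP valsP; have [e se eZ] := frame_completion Lclass fr.
exists e; apply: (presents_tri se wfP) => a b c; rewrite -valsP -frame_tri.
have triZ u u' : u - u' \in saa_center L -> forall v w, tri u v w = tri u' v w.
  move=> /saa_centerP uu' v w; apply/eqP; rewrite -subr_eq0 -triNl -triDl.
  by rewrite /tri uu' form0l.
by rewrite (triZ _ _ (eZ a)) tri_cyc (triZ _ _ (eZ b)) tri_cyc (triZ _ _ (eZ c)) tri_cyc.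
Qed.
End FramePresentation.

Section Presentations.
Variable F : fieldType.

Lemma wf_P1 : pres_wf (P10_3_1 F). Proof. by []. Qed.
Lemma wf_P2 : pres_wf (P10_3_2 F). Proof. by []. Qed.
Lemma wf_P3 : pres_wf (P10_3_3 F). Proof. by []. Qed.

Lemma class_presentation (L : saa F) : in_class L ->
  [\/ has_presentation L (P10_3_1 F), has_presentation L (P10_3_2 F)
    | has_presentation L (P10_3_3 F)].
Proof.
move=> Lclass; have [x1 [x2 [y1 [y2 [y3 [y4 [y5 fr]]]]]]] := ex_frame Lclass.
have [/andP[/eqP x134 /eqP x234] | x34] :=
  boolP ((tri x1 y3 y4 == 0) && (tri x2 y3 y4 == 0)); last first.
  rewrite negb_and in x34; constructor 3.
  have [? [? [? [? [? [? [? [fr' vals]]]]]]]] := normal_nonisotropic Lclass fr x34.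
  apply: (frame_has_presentation Lclass fr' (wf_P3)) => u v w.
  by rewrite vals /pres_tri !big_cons !big_nil /det3 /=; ring.
have [s [z1 [z2 [t1 [t2 [t3 [t4 [t5 [fr' vals]]]]]]]]] := normal_isotropic Lclass fr
  x134 x234.
have [s0 | s0] := eqVneq s 0.
  constructor 1; apply: (frame_has_presentation Lclass fr' (wf_P1)) => u v w.
  by rewrite vals s0 /pres_tri !big_cons !big_nil /det3 /=; ring.
constructor 2; have [? [? [? [? [? [? [? [fr2 vals2]]]]]]]] := normal_rescale s0 fr' vals.
apply: (frame_has_presentation Lclass fr2 (wf_P2)) => u v w.
by rewrite vals2 /pres_tri !big_cons !big_nil /det3 /=; ring.
Qed.
End Presentations.

(** * Invariants *)

(** The first invariant is whether [tri] vanishes on the core, the second one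
    whether it vanishes when two arguments are in the core and the third one is
    in [L^3]. *)

Definition core_abelian (F : fieldType) (L : saa F) : bool :=
  (saa_prodv (core L) (core L) <= perp (core L))%VS.
Definition core_isotropic (F : fieldType) (L : saa F) : bool :=
  (saa_prodv (core L) (core L) <= perp (saa_lower L 3))%VS.

(** * Calculations with lists of generators *)

(** When every pair of generators occurs in at most one entry, the product of
    two basis vectors is a multiple of a basis vector. The spans of sets of
    basis vectors are then closed under products and orthogonal complements,
    so that lower central terms and the like can be computed on lists of
    generators. *)

Section Lists.
Variables (F : fieldType) (P : presentation F).

Definition dualg (g : gen) : gen := match g with inl i => inr i | inr i => inl i end.
Definition gens : seq gen :=
  [:: gx 1; gx 2; gx 3; gx 4; gx 5; gy 1; gy 2; gy 3; gy 4; gy 5].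
(** Up to nonzero factors and duality, the basis vectors occurring in the
    product of [a] and [b]. *)
Definition thirds (a b : gen) : seq gen :=
  [seq c <- gens | has (fun p => perm_eq [:: a; b; c] (entry_gens p)) P].
Definition prods (s t : seq gen) : seq gen :=
  undup (flatten [seq [seq dualg c | c <- thirds a b] | a <- s, b <- t]).
(** The generators whose span is orthogonal to the span of [s]. *)
Definition perps (s : seq gen) : seq gen := [seq dualg g | g <- gens & g \notin s].
Definition lowers (m : nat) : seq gen := iter m.-1 (prods^~ gens) gens.
Definition pres_linear : bool :=
  all (fun a => all (fun b => (size (thirds a b) <= 1)%N) gens) gens.

Lemma dualgK : involutive dualg. Proof. by case. Qed.

Lemma mem_gens g : g \in gens.
Proof. by case: g => -[[|[|[|[|[|i]]]]] lti]; rewrite ?inE. Qed.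

Lemma mem_thirds a b c :
  (c \in thirds a b) = has (fun p => perm_eq [:: a; b; c] (entry_gens p)) P.
Proof. by rewrite mem_filter mem_gens andbT. Qed.

Lemma prodsP s t g :
  reflect (exists a b, [/\ a \in s, b \in t & dualg g \in thirds a b]) (g \in prods s t).
Proof.
rewrite mem_undup; apply: (iffP flattenP) => [[_ /allpairsP[[a b] [/= sa tb ->]]] | ].
  by case/mapP=> c cab ->; exists a, b; rewrite dualgK.
case=> a [b [sa tb gab]]; exists [seq dualg c | c <- thirds a b]; first exact: allpairs_f.
by rewrite -[g]dualgK map_f.
Qed.

Lemma mem_perps s g : (g \in perps s) = (dualg g \notin s).
Proof. by rewrite -[g]dualgK (mem_map (inv_inj dualgK)) mem_filter mem_gens andbT
  dualgK. Qed.
End Lists.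

Section Coordinates.
Variables (F : fieldType) (L : saa F) (P : presentation F) (e : gen -> L).
Hypothesis eP : presents e P.
Hypothesis P_linear : pres_linear P.
Hypothesis P_neq0 : all (fun p => p.2 != 0) P.

Let se : standard_basis e. Proof. by case: eP. Qed.
Let Pe a b c r : (a, b, c, r) \in P -> '[e a ** e b, e c] = r.
Proof. by case: eP => _ Pe _; apply: Pe. Qed.
Let Pe0 a b c : (forall a' b' c' r, (a', b', c', r) \in P ->
  ~~ perm_eq [:: a; b; c] [:: a'; b'; c']) -> '[e a ** e b, e c] = 0.
Proof. by case: eP => _ _; apply. Qed.

Definition cspan (s : seq gen) : {vspace L} := <<map e s>>%VS.

Lemma scoord_lin k u v g : scoord e (k *: u + v) g = k * scoord e u g + scoord e v g.
Proof. by case: g => j; rewrite /= !formE. Qed.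

Lemma scoord0 g : scoord e 0 g = 0.
Proof. by case: g => j; rewrite /= !formE. Qed.

Lemma scoord_gen g h : scoord e (e g) h = (g == h)%:R.
Proof. by case: se => _ xx yy xy; apply: scoord_basis. Qed.

Lemma scoord_dual u g : (scoord e u (dualg g) == 0) = ('[e g, u] == 0).
Proof. by case: g => i //=; rewrite formC oppr_eq0. Qed.

Lemma cspanP s u : reflect (forall g, g \notin s -> scoord e u g = 0) (u \in cspan s).
Proof.
apply: (iffP idP) => [us g gs | u0].
  have := coord_span (X := in_tuple (map e s)) us => ->.
  elim/big_ind: _ => [|v w v0 w0|i _]; first exact: scoord0.
    by rewrite -[v]scale1r scoord_lin v0 w0 mulr0 addr0.
  rewrite -[_ *: _]addr0 scoord_lin scoord0 addr0.
  have lti : (i < size s)%N by rewrite -(size_map e) ltn_ord.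
  rewrite (nth_map (gx 1)) // scoord_gen; case: eqP => [sg | _]; last by rewrite mulr0.
  by move: gs; rewrite -sg mem_nth.
rewrite -(scoordK se u); apply: rpred_sum => g _.
have [gs | gs] := boolP (g \in s); last by rewrite u0 // scale0r mem0v.
by rewrite memvZ // memv_span // map_f.
Qed.

Lemma gen_cspan g s : (e g \in cspan s) = (g \in s).
Proof.
apply/cspanP/idP => [eg | gs h hs]; last first.
  by rewrite scoord_gen; case: eqP hs => // <-; rewrite gs.
apply/negPn/negP => /eg; rewrite scoord_gen eqxx => /eqP.
by rewrite oner_eq0.
Qed.

Lemma cspan_sub s t : (cspan s <= cspan t)%VS = all (mem t) s.
Proof.
apply/span_subvP/allP => [st g gs | st _ /mapP[g gs ->]].
  by rewrite /= -gen_cspan st ?map_f.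
by rewrite gen_cspan; apply: st.
Qed.

Lemma cspan_gens : cspan gens = fullv.
Proof.
by apply/vspaceP => u; rewrite memvf; apply/cspanP => g; rewrite mem_gens.
Qed.

Lemma perp_cspan s : perp (cspan s) = cspan (perps s).
Proof.
apply/vspaceP => u; apply/perpP/cspanP => [u0 g | u0 v /cspanP v0].
  rewrite mem_perps negbK => gs; apply/eqP; rewrite -[g]dualgK scoord_dual u0 //.
  by rewrite gen_cspan.
rewrite -(scoordK se v) form_suml; apply: big1 => g _; rewrite formZl.
have [gs | gs] := boolP (g \in s); last by rewrite v0 // mul0r.
suff /eqP -> : '[e g, u] == 0 by rewrite mulr0.
by rewrite -scoord_dual u0 // mem_perps dualgK gs.
Qed.

Lemma tri_thirds a b c : (tri (e a) (e b) (e c) != 0) = (c \in thirds P a b).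
Proof.
rewrite mem_thirds; apply/idP/idP => [|/hasP[[[[a' b'] c'] r] pP /= abc]].
  apply: contraR => /hasPn nP; apply/eqP/Pe0 => a' b' c' r.
  by move/nP.
apply: (perm3_ind (Q := fun a b c => tri (e a) (e b) (e c) != 0)) abc _ => [x y z /=|x y
  z /=|].
- by rewrite tri_swap oppr_eq0.
- by rewrite (tri_cyc (e z)).
- by rewrite /tri (Pe pP); apply: (allP P_neq0 _ pP).
Qed.

(** For the inclusion of the right hand side, [pres_linear] makes the product of
    two basis vectors a nonzero multiple of a single one. *)
Lemma prodv_cspan s t : saa_prodv (cspan s) (cspan t) = cspan (prods P s t).
Proof.
apply/eqP; rewrite eqEsubv; apply/andP; split.
  rewrite -[cspan (prods _ _ _)]perpK; apply: sub_perpC; apply/subvP => w /perpP w0.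
  apply/perp_prodvP => u v /cspanP u0 /cspanP v0.
  rewrite (tri_scoord se) big1 // => a _; rewrite big1 // => b _; rewrite big1 // => c _.
  have [sa | /u0 ->] := boolP (a \in s); last by rewrite !mul0r.
  have [tb | /v0 ->] := boolP (b \in t); last by rewrite mulr0 !mul0r.
  have [abc | ] := boolP (c \in thirds P a b); last first.
    by rewrite -tri_thirds negbK => /eqP ->; rewrite mulr0.
  suff /eqP -> : scoord e w c == 0 by rewrite mulr0 mul0r.
  rewrite -[c]dualgK scoord_dual w0 // gen_cspan; apply/prodsP.
  by exists a, b; rewrite dualgK.
apply/span_subvP => _ /mapP[g /prodsP[a [b [sa tb gab]]] ->].
have ab : e a ** e b \in saa_prodv (cspan s) (cspan t) by rewrite mem_prodv ?gen_cspan.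
have thirdE h : h \in thirds P a b -> h = dualg g.
  have /allP/(_ a (mem_gens a))/allP/(_ b (mem_gens b)) := P_linear.
  by case: (thirds P a b) gab => [|c []] //=; rewrite !inE => /eqP -> _ /eqP.
pose k := scoord e (e a ** e b) g.
have k0 : k != 0.
  rewrite /k -[g]dualgK scoord_dual formC oppr_eq0.
  by rewrite -/(tri _ _ _) tri_thirds.
have abE : e a ** e b = k *: e g.
  rewrite -(scoordK se (e a ** e b)) (bigD1 g) //= big1 ?addr0 // => h hg.
  suff /eqP -> : scoord e (e a ** e b) h == 0 by rewrite scale0r.
  rewrite -[h]dualgK scoord_dual formC oppr_eq0 -/(tri _ _ _) -[_ == 0]negbK tri_thirds.
  by apply: contra hg => /thirdE hE; rewrite -[h]dualgK hE dualgK.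
by rewrite -[e g](scalerK k0) memvZ // -abE.
Qed.

Hypothesis dimL : \dim {:L} = 10%N.

Lemma lower_cspan m : saa_lower L m = cspan (lowers P m).
Proof.
rewrite /saa_lower /lowers.
elim: m.-1 => [|k IHk] /=; first by rewrite cspan_gens.
by rewrite IHk -cspan_gens prodv_cspan.
Qed.

(** Both this span and its orthogonal complement are spanned by as many vectors as
    stated, and their dimensions add up to 10. *)
Lemma dim_cspan s : (size s + size (perps s) = 10)%N -> \dim (cspan s) = size s.
Proof.
move=> sz; have := dim_perp (cspan s).
rewrite perp_cspan dimL -sz => dims.
have dims1 := dim_span (map e s); have dims2 := dim_span (map e (perps s)).
rewrite !(size_map e) in dims1 dims2; apply/eqP; rewrite eqn_leq dims1 /=.
rewrite -(leq_add2r (size (perps s))) -dims addnC leq_add2l; exact: dims2.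
Qed.

(** The sizes of the complementary lists are included for the sake of
    [dim_cspan]. *)
Definition in_class_check : bool :=
  [&& lowers P 5 == [::],
      all (mem (lowers P 2)) (perps (lowers P 2)),
      (size (lowers P 2) == 7%N) && (size (perps (lowers P 2)) == 3%N)
    & (size (lowers P 3) == 5%N) && (size (perps (lowers P 3)) == 5%N)].

Lemma in_classP : in_class_check -> in_class L.
Proof.
case/and4P=> /eqP l5 iso /andP[/eqP l2 /eqP l2'] /andP[/eqP l3 /eqP l3'].
have low := lower_cspan.
split=> //.
- by exists 4; rewrite low l5 /cspan span_nil.
- rewrite center_perp low => u v uZ vZ.
  have /subvP/(_ u uZ) : (perp (cspan (lowers P 2)) <= cspan (lowers P 2))%VS.
    by rewrite perp_cspan cspan_sub.
  by move=> uL; have /perpP := vZ; apply.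
- apply/eqP; rewrite center_perp -(eqn_add2r 7) low -{1}l2.
  by rewrite -dim_cspan ?l2 ?l2' // dim_perp dimL.
- by rewrite low dim_cspan ?l3 ?l3'.
Qed.

Definition core_gens : seq gen := perps (prods P (lowers P 2) (lowers P 2)).

Lemma core_cspan : core L = cspan core_gens.
Proof.
by rewrite /core central_orthE lower_cspan prodv_cspan perp_cspan /core_gens.
Qed.

Lemma core_abelianE :
  core_abelian L = all (mem (perps core_gens)) (prods P core_gens core_gens).
Proof.
rewrite /core_abelian core_cspan; move: core_gens => s.
by rewrite prodv_cspan perp_cspan cspan_sub.
Qed.

Lemma core_isotropicE :
  core_isotropic L = all (mem (perps (lowers P 3))) (prods P core_gens core_gens).
Proof.
rewrite /core_isotropic core_cspan; move: core_gens => s.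
by rewrite lower_cspan prodv_cspan perp_cspan cspan_sub.
Qed.
End Coordinates.

(** * Invariance under isomorphism *)

Section Iso.
Variables (F : fieldType) (L M : saa F) (f : {linear L -> M}).
Hypotheses (f_bij : bijective f) (f_mul : forall u v, f (u ** v) = f u ** f v).
Hypothesis f_form : forall u v, '[f u, f v] = '[u, v].
Local Notation g := (linfun f).

Lemma limg_iso_full : (g @: fullv)%VS = fullv.
Proof.
case: f_bij => h fK hK; apply/vspaceP => w; rewrite memvf -[w]hK -(lfunE f).
by rewrite memv_img ?memvf.
Qed.

Lemma limg_prodv U V : (g @: saa_prodv U V)%VS = saa_prodv (g @: U) (g @: V).
Proof.
apply/eqP; rewrite eqEsubv; apply/andP; split.
  apply/subvP => _ /memv_imgP[u uUV ->]; rewrite memv_preim.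
  move: u uUV; apply/subvP/saa_prodvP => u v uU vV.
  by rewrite -memv_preim lfunE f_mul -!(lfunE f) mem_prodv ?memv_img.
apply/saa_prodvP => _ _ /memv_imgP[u uU ->] /memv_imgP[v vV ->].
by rewrite !lfunE /= -f_mul -(lfunE f) memv_img ?mem_prodv.
Qed.

Lemma limg_perp U : (g @: perp U)%VS = perp (g @: U).
Proof.
apply/vspaceP => w; apply/memv_imgP/perpP => [[u /perpP uU ->] _ /memv_imgP[v vU ->] |
  w0].
  by rewrite !lfunE /= f_form uU.
have : w \in (g @: fullv)%VS by rewrite limg_iso_full memvf.
case/memv_imgP=> u _ wE; exists u => //; apply/perpP => v vU.
by rewrite -f_form -!(lfunE f) -wE w0 ?memv_img.
Qed.

Lemma limg_lower m : (g @: saa_lower L m)%VS = saa_lower M m.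
Proof.
rewrite /saa_lower; elim: m.-1 => [|k IHk] /=; first exact: limg_iso_full.
by rewrite limg_prodv IHk limg_iso_full.
Qed.

Lemma limg_core : (g @: core L)%VS = core M.
Proof. by rewrite /core limg_perp limg_prodv !central_orthE limg_lower. Qed.
End Iso.

Lemma iso_core (F : fieldType) (L M : saa F) : saa_iso L M ->
  (core_abelian L -> core_abelian M) /\ (core_isotropic L -> core_isotropic M).
Proof.
case=> f [fb fm ff]; split=> /(limgS (linfun f)).
  by rewrite limg_prodv // limg_perp // limg_core.
by rewrite limg_prodv // limg_perp // limg_core // limg_lower.
Qed.

(** * The three algebras *)

Section Checks.
Variable F : fieldType.

Lemma P1_linear : pres_linear (P10_3_1 F).
Proof. exact: (erefl true). Qed.
Lemma P1_neq0 : all (fun p => p.2 != 0) (P10_3_1 F).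
Proof. by rewrite /= oner_eq0. Qed.
Lemma P1_check : in_class_check (P10_3_1 F).
Proof. exact: (erefl true). Qed.
Lemma P1_presents : presents (@unitv F : gen -> pres_alg (P10_3_1 F)) (P10_3_1 F).
Proof. exact: pres_alg_presents (wf_P1 F). Qed.

Lemma P2_linear : pres_linear (P10_3_2 F).
Proof. exact: (erefl true). Qed.
Lemma P2_neq0 : all (fun p => p.2 != 0) (P10_3_2 F).
Proof. by rewrite /= oner_eq0. Qed.
Lemma P2_check : in_class_check (P10_3_2 F).
Proof. exact: (erefl true). Qed.
Lemma P2_presents : presents (@unitv F : gen -> pres_alg (P10_3_2 F)) (P10_3_2 F).
Proof. exact: pres_alg_presents (wf_P2 F). Qed.

Lemma P3_linear : pres_linear (P10_3_3 F).
Proof. exact: (erefl true). Qed.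
Lemma P3_neq0 : all (fun p => p.2 != 0) (P10_3_3 F).
Proof. by rewrite /= oner_eq0. Qed.
Lemma P3_check : in_class_check (P10_3_3 F).
Proof. exact: (erefl true). Qed.
Lemma P3_presents : presents (@unitv F : gen -> pres_alg (P10_3_3 F)) (P10_3_3 F).
Proof. exact: pres_alg_presents (wf_P3 F). Qed.

Lemma P1_core_abelian : core_abelian (pres_alg (P10_3_1 F)) = true.
Proof.
rewrite (core_abelianE P1_presents P1_linear P1_neq0).
exact: (erefl true).
Qed.

Lemma P2_core_abelian : core_abelian (pres_alg (P10_3_2 F)) = false.
Proof.
rewrite (core_abelianE P2_presents P2_linear P2_neq0).
exact: (erefl false).
Qed.

Lemma P1_core_isotropic : core_isotropic (pres_alg (P10_3_1 F)) = true.
Proof.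
rewrite (core_isotropicE P1_presents P1_linear P1_neq0).
exact: (erefl true).
Qed.

Lemma P2_core_isotropic : core_isotropic (pres_alg (P10_3_2 F)) = true.
Proof.
rewrite (core_isotropicE P2_presents P2_linear P2_neq0).
exact: (erefl true).
Qed.

Lemma P3_core_isotropic : core_isotropic (pres_alg (P10_3_3 F)) = false.
Proof.
rewrite (core_isotropicE P3_presents P3_linear P3_neq0).
exact: (erefl false).
Qed.

End Checks.

Theorem proposition7p6 (F : fieldType) :
  exists L1 L2 L3 : saa F,
    [/\ [/\ has_presentation L1 (P10_3_1 F),
            has_presentation L2 (P10_3_2 F)
          & has_presentation L3 (P10_3_3 F)],
        [/\ in_class L1, in_class L2 & in_class L3],
        [/\ ~ saa_iso L1 L2, ~ saa_iso L1 L3 & ~ saa_iso L2 L3]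
      & forall L : saa F, in_class L ->
          [\/ saa_iso L L1, saa_iso L L2 | saa_iso L L3]].
Proof.
have has1 : has_presentation (pres_alg (P10_3_1 F)) (P10_3_1 F).
  by eexists; exact: P1_presents.
have has2 : has_presentation (pres_alg (P10_3_2 F)) (P10_3_2 F).
  by eexists; exact: P2_presents.
have has3 : has_presentation (pres_alg (P10_3_3 F)) (P10_3_3 F).
  by eexists; exact: P3_presents.
exists (pres_alg (P10_3_1 F)), (pres_alg (P10_3_2 F)), (pres_alg (P10_3_3 F)).
split; first by split; [exact: has1 | exact: has2 | exact: has3].
- split.
  + exact: in_classP (P1_presents F) (P1_linear F) (P1_neq0 F) (dim_pres_alg _)
    (P1_check F).
  + exact: in_classP (P2_presents F) (P2_linear F) (P2_neq0 F) (dim_pres_alg _)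
    (P2_check F).
  + exact: in_classP (P3_presents F) (P3_linear F) (P3_neq0 F) (dim_pres_alg _)
    (P3_check F).
- split=> LM; have [ab iso] := iso_core LM.
  + by move: ab; rewrite P1_core_abelian P2_core_abelian => /(_ isT).
  + by move: iso; rewrite P1_core_isotropic P3_core_isotropic => /(_ isT).
  + by move: iso; rewrite P2_core_isotropic P3_core_isotropic => /(_ isT).
move=> L /class_presentation[] LP; [constructor 1 | constructor 2 | constructor 3].
- exact: has_presentation_iso LP has1.
- exact: has_presentation_iso LP has2.
- exact: has_presentation_iso LP has3.
Qed.
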